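(* Let $\psi\in A(\mathbb{D})$ with $\psi\not\equiv 0$, and let $\psi A(\mathbb{D})=\{\psi f: f\in A(\mathbb{D})\}$. Then a map $T:\psi A(\mathbb{D})\to\psi A(\mathbb{D})$ is an automorphism of $\psi A(\mathbb{D})$ if and only if $T=C_\varphi$ (restricted to $\psi A(\mathbb{D})$) for some $\varphi\in\mathrm{Aut}(\mathbb{D})$ such that $\psi\circ\varphi=\psi g$, where $g$ is an invertible element of $A(\mathbb{D})$.
   Context: $\mathbb{D}$ is the open unit disc in $\mathbb{C}$; $\mathrm{Aut}(\mathbb{D})$ is the set of bijective analytic self-maps of $\mathbb{D}$ (each extends to a homeomorphism of $\overline{\mathbb{D}}$). $A(\mathbb{D})$ is the disc algebra: continuous functions on $\overline{\mathbb{D}}$ that are analytic in $\mathbb{D}$, with pointwise operations. $C_\varphi f=f\circ\varphi$. An automorphism of a (not necessarily unital or closed) subalgebra is a bijective, linear, multiplicative self-map of it (no continuity is assumed). An element $g\in A(\mathbb{D})$ is invertible if there is $h\in A(\mathbb{D})$ with $gh\equiv 1$. *)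

(* Defs.v *)
From Stdlib Require Import Reals Lra.
From Coquelicot Require Import Coquelicot.
Open Scope R_scope.

Definition open_disc (z : C) : Prop := Cmod z < 1.

Definition closed_disc : Type := {z : C | Cmod z <= 1}.

Definition cdval (z : closed_disc) : C := proj1_sig z.

Lemma Cmod_zero_le_1 : Cmod 0 <= 1.
Proof. rewrite Cmod_0; lra. Qed.

Definition zero_in_closed_disc : closed_disc :=
  exist _ (RtoC 0) Cmod_zero_le_1.

(* The uniform structure induced from C, so that [continuous] below refers to
   the subspace topology of the closed disc. *)
Definition closed_disc_ball (x : closed_disc) (eps : R) (y : closed_disc) :=
  ball (cdval x) eps (cdval y).

Definition closed_disc_UniformSpace_mixin :
  UniformSpace.mixin_of closed_disc :=
  UniformSpace.Mixin closed_disc zero_in_closed_disc closed_disc_ball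
    (fun x => ball_center (cdval x))
    (fun x y => ball_sym (cdval x) (cdval y))
    (fun x y z => ball_triangle (cdval x) (cdval y) (cdval z)).

Canonical closed_disc_UniformSpace : UniformSpace :=
  UniformSpace.Pack closed_disc closed_disc_UniformSpace_mixin closed_disc.

(* [ex_derive] over the field C is complex differentiability. *)
Definition analytic_in_disc (F : C -> C) : Prop :=
  forall z : C, open_disc z -> @ex_derive C_AbsRing C_NormedModule F z.

(* A function on the closed disc is analytic in the open disc when some total
   function agreeing with it on the closed disc is; at interior points the
   derivative does not depend on the values chosen outside. *)
Definition disc_algebra (f : closed_disc -> C) : Prop :=
  (forall z : closed_disc, continuous f z) /\
  exists F : C -> C,
    (forall z : closed_disc, F (cdval z) = f z) /\ analytic_in_disc F.

Definition disc_algebra_invertible (g : closed_disc -> C) : Prop :=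
  disc_algebra g /\
  exists h : closed_disc -> C,
    disc_algebra h /\ forall z : closed_disc, (g z * h z)%C = 1.

Definition principal_ideal (psi h : closed_disc -> C) : Prop :=
  exists f : closed_disc -> C,
    disc_algebra f /\ h = (fun z => psi z * f z)%C.

Definition maps_into {X : Type} (S : X -> Prop) (f : X -> X) : Prop :=
  forall x : X, S x -> S (f x).

Definition bijective_on {X : Type} (S : X -> Prop) (f : X -> X) : Prop :=
  maps_into S f /\
  (forall x y : X, S x -> S y -> f x = f y -> x = y) /\
  (forall y : X, S y -> exists x : X, S x /\ f x = y).

(* Only the values of T on S matter. *)
Definition algebra_automorphism_on (S : (closed_disc -> C) -> Prop)
    (T : (closed_disc -> C) -> (closed_disc -> C)) : Prop :=
  bijective_on S T /\
  (forall f g : closed_disc -> C, S f -> S g ->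
     T (fun z => f z + g z)%C = (fun z => T f z + T g z)%C) /\
  (forall (c : C) (f : closed_disc -> C), S f ->
     T (fun z => c * f z)%C = (fun z => c * T f z)%C) /\
  (forall f g : closed_disc -> C, S f -> S g ->
     T (fun z => f z * g z)%C = (fun z => T f z * T g z)%C).

(* The values of phi outside the open disc are irrelevant. *)
Definition disc_automorphism (phi : C -> C) : Prop :=
  bijective_on open_disc phi /\ analytic_in_disc phi.

(* By density of the open disc there is at most one such Phi for a given phi. *)
Definition continuous_extension (phi : C -> C)
    (Phi : closed_disc -> closed_disc) : Prop :=
  (forall z : closed_disc, continuous Phi z) /\
  (forall z : closed_disc, open_disc (cdval z) -> cdval (Phi z) = phi (cdval z)).

Definition composition_operator (Phi : closed_disc -> closed_disc)
    (f : closed_disc -> C) : closed_disc -> C :=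
  fun z => f (Phi z).

(* Main.v *)
Require Import Defs.
From Stdlib Require Import Reals Lra Lia Psatz.
From Stdlib Require Import ClassicalEpsilon FunctionalExtensionality ProofIrrelevance.
From Coquelicot Require Import Coquelicot.

(** For an automorphism T of psi A(D) and a point w with T psi (w) <> 0, the map
    f |-> T (psi f) (w) / T psi (w) is a character of A(D).  A character takes each
    f to a value of f, since an element without zeros is invertible; dividing by
    z - a (for a inside the disc), respectively multiplying by powers of a peak
    function (for a on the circle), shows that it is evaluation at a = chi(z).
    Hence T h = h o phi off the zeros of T psi, with phi = T (psi z) / T psi, whose
    singularities are removable.  The same for the inverse of T gives an analytic
    inverse of phi, so phi is a Moebius map and extends to the closed disc; then
    T psi = psi g and T^-1 psi = psi k give g (k o phi) = 1.

    The function theory rests on the maximum principle alone.  Goursat's bisection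
    in polar coordinates gives the mean value property.  The maximum principle for
    functions that are only locally bounded at exceptional points then yields
    removable singularities, by comparing difference quotients, and from these
    the orders of zeros, Schwarz' lemma, the open mapping theorem and the
    description of Aut(D). *)

(** * Goursat's theorem for real one-forms *)

(** The ideal psi A(D) need not contain 1, so [T] has no value there to normalise by, and h |-> T h
    (w) is multiplicative on the ideal only. The extra factor psi is what carries this functional
    over to all of A(D). The price is that everything is known only off the zeros of T psi. These
    must therefore be isolated and the singularities there removable, which is why so much function
    theory enters an algebraic statement. No continuity of [T] is available. The only control on the
    size of a character is that its values lie in the ranges of the functions it is applied to; on
    the circle, where division by z - a leaves the algebra, this is what makes the peak function
    work. A second obstacle is the boundary. At first phi is only known to map into the closed disc;
    a value on the circle would make it constant, against the injectivity of [T]. And an analytic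
    bijection of the open disc says nothing about the circle by itself: the continuous extension
    comes from the explicit Moebius form. *)

Definition circulation (P Q : R -> R -> R) (a b c d : R) : R :=
  RInt (fun x => P x c - P x d) a b + RInt (fun y => Q b y - Q a y) c d.

(** The supremum of the left ends works. The lemma is applied to each coordinate of a sequence of
    rectangles separately. *)
Lemma nested_rectangles (u : nat -> R * R) :
  (forall n, fst (u n) <= snd (u n)) ->
  (forall n, fst (u n) <= fst (u (S n)) /\ snd (u (S n)) <= snd (u n)) ->
  exists x, forall n, fst (u n) <= x <= snd (u n).
Proof.
  intros Hle Hmon.
  assert (Hf : forall n k, fst (u n) <= fst (u (n + k)%nat)).
  { intros n k; induction k as [|k IH]; [rewrite Nat.add_0_r; lra|].
    rewrite Nat.add_succ_r; destruct (Hmon (n + k)%nat); lra. }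
  assert (Hs : forall n k, snd (u (n + k)%nat) <= snd (u n)).
  { intros n k; induction k as [|k IH]; [rewrite Nat.add_0_r; lra|].
    rewrite Nat.add_succ_r; destruct (Hmon (n + k)%nat); lra. }
  assert (Hub : forall n m, fst (u m) <= snd (u n)).
  { intros n m. specialize (Hf m n); specialize (Hs n m).
    rewrite (Nat.add_comm n m) in Hs. specialize (Hle (m + n)%nat); lra. }
  destruct (completeness (fun r => exists n, r = fst (u n))) as [x [Hx1 Hx2]].
  - exists (snd (u 0%nat)); intros r [n ->]; apply Hub.
  - exists (fst (u 0%nat)); now exists 0%nat.
  - exists x; intros n; split.
    + apply Hx1; now exists n.
    + apply Hx2; intros r [m ->]; apply Hub.
Qed.

(* Goursat's bisection, as an induction principle: the contrapositive produces
   a nested sequence of bad rectangles. *)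
Lemma rectangle_induction (good : R -> R -> R -> R -> Prop) (a b c d : R) :
  a <= b -> c <= d ->
  (forall x x' y y', x <= x' -> y <= y' ->
     let mx := (x + x') / 2 in let my := (y + y') / 2 in
     a <= x -> x' <= b -> c <= y -> y' <= d ->
     good x mx y my -> good mx x' y my -> good x mx my y' -> good mx x' my y' ->
     good x x' y y') ->
  (forall x0 y0, a <= x0 <= b -> c <= y0 <= d -> exists delta, 0 < delta /\
     forall x x' y y', x <= x0 <= x' -> y <= y0 <= y' ->
       a <= x -> x' <= b -> c <= y -> y' <= d ->
       x' - x < delta -> y' - y < delta -> good x x' y y') ->
  good a b c d.
Proof.
  intros Hab Hcd Hstep Hloc.
  apply NNPP; intros Hbad.
  pose (inv := fun r : (R * R) * (R * R) =>
    a <= fst (fst r) /\ snd (fst r) <= b /\ c <= fst (snd r) /\ snd (snd r) <= d /\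
    fst (fst r) <= snd (fst r) /\ fst (snd r) <= snd (snd r) /\
    ~ good (fst (fst r)) (snd (fst r)) (fst (snd r)) (snd (snd r))).
  (* Conditional on [inv r], so that every r has a successor and choice yields a total [next]. *)
  pose (half := fun (r s : (R * R) * (R * R)) => inv r -> inv s /\
    fst (fst r) <= fst (fst s) /\ snd (fst s) <= snd (fst r) /\
    fst (snd r) <= fst (snd s) /\ snd (snd s) <= snd (snd r) /\
    snd (fst s) - fst (fst s) = (snd (fst r) - fst (fst r)) / 2 /\
    snd (snd s) - fst (snd s) = (snd (snd r) - fst (snd r)) / 2).
  assert (Hhalf : forall r, exists s, half r s).
  { intros [[x x'] [y y']].
    destruct (classic (inv ((x, x'), (y, y')))) as [Hi|Hi];
      [|exists ((x, x'), (y, y')); intros H; contradiction].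
    generalize Hi; intros (H1 & H2 & H3 & H4 & H5 & H6 & H7); simpl in *.
    apply NNPP; intros Hno. apply H7.
    apply Hstep; auto; apply NNPP; intros Hn; apply Hno.
    - exists ((x, (x + x') / 2), (y, (y + y') / 2)); intros _; unfold inv; simpl;
        repeat split; try assumption; lra.
    - exists (((x + x') / 2, x'), (y, (y + y') / 2)); intros _; unfold inv; simpl;
        repeat split; try assumption; lra.
    - exists ((x, (x + x') / 2), ((y + y') / 2, y')); intros _; unfold inv; simpl;
        repeat split; try assumption; lra.
    - exists (((x + x') / 2, x'), ((y + y') / 2, y')); intros _; unfold inv; simpl;
        repeat split; try assumption; lra. }
  pose (next := fun r => proj1_sig (constructive_indefinite_description _ (Hhalf r))).
  assert (Hnext : forall r, half r (next r))
    by (intros r; apply (proj2_sig (constructive_indefinite_description _ (Hhalf r)))).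
  pose (u := fix u (n : nat) := match n with O => ((a, b), (c, d)) | S n => next (u n) end).
  assert (Hinv : forall n, inv (u n)).
  { intros n; induction n as [|n IH].
    - unfold inv; simpl; repeat split; auto; lra.
    - apply (Hnext (u n) IH). }
  assert (Hsz : forall n, snd (fst (u n)) - fst (fst (u n)) = (b - a) * (/ 2) ^ n /\
                          snd (snd (u n)) - fst (snd (u n)) = (d - c) * (/ 2) ^ n).
  { intros n; induction n as [|n [IH1 IH2]]; [simpl; lra|].
    destruct (Hnext (u n) (Hinv n)) as (_ & _ & _ & _ & _ & E1 & E2).
    change (u (S n)) with (next (u n)). rewrite E1, E2, IH1, IH2. simpl; lra. }
  destruct (nested_rectangles (fun n => fst (u n))) as [x0 Hx0].
  { intros n; apply (Hinv n). }
  { intros n; destruct (Hnext (u n) (Hinv n)) as (_ & E); split; apply E. }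
  destruct (nested_rectangles (fun n => snd (u n))) as [y0 Hy0].
  { intros n; apply (Hinv n). }
  { intros n; destruct (Hnext (u n) (Hinv n)) as (_ & E); split; apply E. }
  destruct (Hloc x0 y0 (Hx0 0%nat) (Hy0 0%nat)) as [delta [Hd HH]].
  (* Makes both side lengths at stage N smaller than delta; the summand 1 keeps the divisor positive
     for degenerate rectangles. *)
  destruct (pow_lt_1_zero (/ 2)) with (y := delta / ((b - a) + (d - c) + 1)) as [N HN].
  { rewrite Rabs_pos_eq; lra. }
  { apply Rdiv_lt_0_compat; lra. }
  specialize (HN N (Nat.le_refl N)).
  assert (Hp : 0 < (/ 2) ^ N) by (apply pow_lt; lra).
  rewrite Rabs_pos_eq in HN by lra.
  apply Rmult_lt_compat_r with (r := (b - a) + (d - c) + 1) in HN; [|lra].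
  unfold Rdiv in HN; rewrite Rmult_assoc, Rinv_l, Rmult_1_r in HN by lra.
  destruct (Hinv N) as (I1 & I2 & I3 & I4 & I5 & I6 & I7).
  destruct (Hsz N) as [S1 S2].
  apply I7, HH; auto; try apply Hx0; try apply Hy0; try (rewrite S1 || rewrite S2); nra.
Qed.

Lemma RInt_near_const (f : R -> R) (v M a b : R) :
  a <= b -> ex_RInt f a b -> (forall t, a <= t <= b -> Rabs (f t - v) <= M) ->
  Rabs (RInt f a b - v * (b - a)) <= M * (b - a).
Proof.
  intros Hab Hex HM.
  replace (RInt f a b - v * (b - a)) with (RInt (fun t => f t - v) a b).
  - rewrite (Rmult_comm M). apply abs_RInt_le_const; auto.
    apply (@ex_RInt_minus R_NormedModule); [exact Hex | apply ex_RInt_const].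
  - rewrite (RInt_minus f (fun _ => v)) by (auto; apply ex_RInt_const).
    rewrite RInt_const. unfold minus, plus, opp, scal; simpl; unfold mult; simpl. ring.
Qed.

Lemma ex_RInt_section_l (P : R -> R -> R) (a b y : R) :
  a <= b -> (forall x, a <= x <= b -> continuity_2d_pt P x y) ->
  ex_RInt (fun x => P x y) a b.
Proof.
  intros Hab H. apply (@ex_RInt_continuous R_CompleteNormedModule).
  intros x Hx. rewrite Rmin_left, Rmax_right in Hx by lra.
  apply filterlim_locally; intros eps.
  destruct (H x Hx eps) as [delta Hd].
  exists delta; intros t Ht. apply Hd; [exact Ht|].
  rewrite Rminus_diag, Rabs_R0; apply cond_pos.
Qed.

Lemma ex_RInt_section_r (P : R -> R -> R) (x c d : R) :
  c <= d -> (forall y, c <= y <= d -> continuity_2d_pt P x y) ->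
  ex_RInt (fun y => P x y) c d.
Proof.
  intros Hcd H. apply (@ex_RInt_continuous R_CompleteNormedModule).
  intros y Hy. rewrite Rmin_left, Rmax_right in Hy by lra.
  apply filterlim_locally; intros eps.
  destruct (H y Hy eps) as [delta Hd].
  exists delta; intros t Ht. apply Hd; [|exact Ht].
  rewrite Rminus_diag, Rabs_R0; apply cond_pos.
Qed.

(** Each inner edge is traversed twice, in opposite directions. *)
Lemma circulation_split (P Q : R -> R -> R) (a m b c n d : R) :
  a <= m <= b -> c <= n <= d ->
  (forall x y, a <= x <= b -> c <= y <= d ->
     continuity_2d_pt P x y /\ continuity_2d_pt Q x y) ->
  circulation P Q a b c d =
    circulation P Q a m c n + circulation P Q m b c n +
    circulation P Q a m n d + circulation P Q m b n d.
Proof.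
  intros Hm Hn HC. unfold circulation.
  assert (EP : forall x x' y, a <= x -> x <= x' -> x' <= b -> c <= y <= d ->
     ex_RInt (fun x => P x y) x x').
  { intros x x' y H1 H2 H3 H4. apply ex_RInt_section_l; auto.
    intros t Ht; apply HC; lra. }
  assert (EQ : forall x y y', a <= x <= b -> c <= y -> y <= y' -> y' <= d ->
     ex_RInt (fun y => Q x y) y y').
  { intros x y y' H1 H2 H3 H4. apply ex_RInt_section_r; auto.
    intros t Ht; apply HC; lra. }
  assert (SP : forall x x' y y', a <= x -> x <= x' -> x' <= b -> c <= y <= d -> c <= y' <= d ->
     RInt (fun t => P t y - P t y') x x' = RInt (fun t => P t y) x x' - RInt (fun t => P t y') x x').
  { intros; apply (RInt_minus (fun t => P t y) (fun t => P t y')); apply EP; auto. }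
  assert (SQ : forall x x' y y', a <= x <= b -> a <= x' <= b -> c <= y -> y <= y' -> y' <= d ->
     RInt (fun t => Q x t - Q x' t) y y' = RInt (fun t => Q x t) y y' - RInt (fun t => Q x' t) y y').
  { intros; apply (RInt_minus (fun t => Q x t) (fun t => Q x' t)); apply EQ; auto. }
  assert (CP : forall y, c <= y <= d ->
     RInt (fun t => P t y) a b = RInt (fun t => P t y) a m + RInt (fun t => P t y) m b).
  { intros y Hy; symmetry; apply (RInt_Chasles (fun t => P t y)); apply EP; lra. }
  assert (CQ : forall x, a <= x <= b ->
     RInt (fun t => Q x t) c d = RInt (fun t => Q x t) c n + RInt (fun t => Q x t) n d).
  { intros x Hx; symmetry; apply (RInt_Chasles (fun t => Q x t)); apply EQ; lra. }
  rewrite !SP, !SQ, !CP, !CQ by lra. ring.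
Qed.

Lemma differentiable_pt_lim_continuity (P : R -> R -> R) (x y lx ly : R) :
  differentiable_pt_lim P x y lx ly -> continuity_2d_pt P x y.
Proof. intros H; apply differentiable_continuity_pt; now exists lx, ly. Qed.

(** The shared q says that P dx + Q dy is closed. Continuity of the partial derivatives is not
    assumed, which is why bisection is used instead of Green's formula. *)
Lemma goursat (P Q : R -> R -> R) (a b c d : R) :
  a <= b -> c <= d ->
  (forall x y, a <= x <= b -> c <= y <= d -> exists p q r,
     differentiable_pt_lim P x y p q /\ differentiable_pt_lim Q x y q r) ->
  circulation P Q a b c d = 0.
Proof.
  intros Hab Hcd HD.
  assert (HC : forall x y, a <= x <= b -> c <= y <= d ->
     continuity_2d_pt P x y /\ continuity_2d_pt Q x y).
  { intros x y Hx Hy; destruct (HD x y Hx Hy) as (p & q & r & H1 & H2).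
    split; eapply differentiable_pt_lim_continuity; eauto. }
  (* The square of the half perimeter is exactly additive under quartering: each quarter has half of
     the half perimeter, hence a fourth of its square. *)
  assert (Hmain : forall eps, 0 < eps ->
    Rabs (circulation P Q a b c d) <= eps * ((b - a) + (d - c)) ^ 2).
  { intros eps Heps.
    apply (rectangle_induction (fun x x' y y' =>
      Rabs (circulation P Q x x' y y') <= eps * ((x' - x) + (y' - y)) ^ 2)); auto.
    - intros x x' y y' Hx Hy mx my Hax Hxb Hcy Hyd G1 G2 G3 G4.
      rewrite (circulation_split P Q x mx x' y my y');
        [|unfold mx; lra|unfold my; lra|intros; apply HC; lra].
      pose proof (Rabs_triang (circulation P Q x mx y my + circulation P Q mx x' y my +
        circulation P Q x mx my y') (circulation P Q mx x' my y')).
      pose proof (Rabs_triang (circulation P Q x mx y my + circulation P Q mx x' y my)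
        (circulation P Q x mx my y')).
      pose proof (Rabs_triang (circulation P Q x mx y my) (circulation P Q mx x' y my)).
      unfold mx, my in *.
      replace (eps * (x' - x + (y' - y)) ^ 2) with
        (eps * ((x + x') / 2 - x + ((y + y') / 2 - y)) ^ 2 +
         eps * (x' - (x + x') / 2 + ((y + y') / 2 - y)) ^ 2 +
         eps * ((x + x') / 2 - x + (y' - (y + y') / 2)) ^ 2 +
         eps * (x' - (x + x') / 2 + (y' - (y + y') / 2)) ^ 2) by field.
      lra.
    - intros x0 y0 Hx0 Hy0.
      destruct (HD x0 y0 Hx0 Hy0) as (p & q & r & HP & HQ).
      assert (He2 : 0 < eps / 2) by lra.
      destruct (HP (mkposreal _ He2)) as [d1 H1].
      destruct (HQ (mkposreal _ He2)) as [d2 H2].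
      simpl in H1, H2.
      exists (Rmin d1 d2); split; [apply Rmin_pos; apply cond_pos|].
      intros x x' y y' Hx Hy Hax Hxb Hcy Hyd Sx Sy.
      pose proof (Rmin_l d1 d2); pose proof (Rmin_r d1 d2).
      set (s := (x' - x) + (y' - y)).
      assert (HB : forall u v, x <= u <= x' -> y <= v <= y' ->
         Rabs (u - x0) < Rmin d1 d2 /\ Rabs (v - y0) < Rmin d1 d2 /\
         eps / 2 * Rmax (Rabs (u - x0)) (Rabs (v - y0)) <= eps / 2 * s).
      { intros u v Hu Hv.
        assert (Rabs (u - x0) <= x' - x) by (apply Rabs_le; lra).
        assert (Rabs (v - y0) <= y' - y) by (apply Rabs_le; lra).
        split; [lra|split; [lra|]].
        apply Rmult_le_compat_l; [lra|]. apply Rmax_lub; unfold s; lra. }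
      assert (BP : Rabs (RInt (fun t => P t y - P t y') x x' - q * (y - y') * (x' - x))
         <= eps * s * (x' - x)).
      { apply RInt_near_const; [lra| |].
        - apply (@ex_RInt_minus R_NormedModule); apply ex_RInt_section_l; try lra;
            intros; apply HC; lra.
        - intros t Ht.
          destruct (HB t y) as (A1 & A2 & A3); [lra|lra|].
          destruct (HB t y') as (B1 & B2 & B3); [lra|lra|].
          specialize (H1 t y ltac:(lra) ltac:(lra)) as C1.
          specialize (H1 t y' ltac:(lra) ltac:(lra)) as C2.
          replace (P t y - P t y' - q * (y - y')) with
            ((P t y - P x0 y0 - (p * (t - x0) + q * (y - y0))) -
             (P t y' - P x0 y0 - (p * (t - x0) + q * (y' - y0)))) by ring.
          eapply Rle_trans; [apply Rabs_triang|]. rewrite Rabs_Ropp. lra. }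
      assert (BQ : Rabs (RInt (fun t => Q x' t - Q x t) y y' - q * (x' - x) * (y' - y))
         <= eps * s * (y' - y)).
      { apply RInt_near_const; [lra| |].
        - apply (@ex_RInt_minus R_NormedModule); apply ex_RInt_section_r; try lra;
            intros; apply HC; lra.
        - intros t Ht.
          destruct (HB x' t) as (A1 & A2 & A3); [lra|lra|].
          destruct (HB x t) as (B1 & B2 & B3); [lra|lra|].
          specialize (H2 x' t ltac:(lra) ltac:(lra)) as C1.
          specialize (H2 x t ltac:(lra) ltac:(lra)) as C2.
          replace (Q x' t - Q x t - q * (x' - x)) with
            ((Q x' t - Q x0 y0 - (q * (x' - x0) + r * (t - y0))) -
             (Q x t - Q x0 y0 - (q * (x - x0) + r * (t - y0)))) by ring.
          eapply Rle_trans; [apply Rabs_triang|]. rewrite Rabs_Ropp. lra. }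
      unfold circulation.
      (* The linear parts contribute q (y - y') (x' - x) and q (x' - x) (y' - y), which cancel; only
         the differentiability errors remain. *)
      replace (RInt (fun t => P t y - P t y') x x' + RInt (fun t => Q x' t - Q x t) y y')
        with ((RInt (fun t => P t y - P t y') x x' - q * (y - y') * (x' - x)) +
              (RInt (fun t => Q x' t - Q x t) y y' - q * (x' - x) * (y' - y))) by ring.
      eapply Rle_trans; [apply Rabs_triang|].
      replace (eps * s ^ 2) with (eps * s * (x' - x) + eps * s * (y' - y))
        by (unfold s; ring).
      lra. }
  apply NNPP; intros Hne.
  pose proof (Rabs_pos_lt _ Hne) as Hpos.
  set (A := ((b - a) + (d - c)) ^ 2) in *.
  assert (HA : 0 <= A) by (unfold A; nra).
  (* For this eps the bound is at most half of the circulation itself; A + 1 avoids a division by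
     0. *)
  specialize (Hmain (Rabs (circulation P Q a b c d) / (2 * (A + 1)))
    ltac:(apply Rdiv_lt_0_compat; lra)).
  assert (Rabs (circulation P Q a b c d) / (2 * (A + 1)) * A <= Rabs (circulation P Q a b c d) / 2).
  { replace (Rabs (circulation P Q a b c d) / 2) with
      (Rabs (circulation P Q a b c d) / (2 * (A + 1)) * (A + 1)) by (field; lra).
    apply Rmult_le_compat_l; [|lra]. apply Rlt_le, Rdiv_lt_0_compat; lra. }
  lra.
Qed.

(** * Limits and complex differentiability *)

(** Estimates are in the modulus and the filter is arbitrary, so one calculus of limits serves
    neighbourhoods in C, punctured neighbourhoods and the closed disc. *)
Definition Clim {X : Type} (F : (X -> Prop) -> Prop) (f : X -> C) (l : C) : Prop :=
  forall eps, 0 < eps -> F (fun x => Cmod (f x - l) < eps).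

(* [locally] on C refers to the product structure R * R; this is the filter for
   the modulus. *)
Definition nearC (z : C) : (C -> Prop) -> Prop :=
  @locally (AbsRing_UniformSpace C_AbsRing) z.

Global Instance nearC_filter (z : C) : ProperFilter (nearC z).
Proof. apply (@locally_filter (AbsRing_UniformSpace C_AbsRing)). Qed.

Lemma nearC_singleton (z : C) (P : C -> Prop) : nearC z P -> P z.
Proof. apply (@locally_singleton (AbsRing_UniformSpace C_AbsRing)). Qed.

Lemma nearC_iff (z : C) (P : C -> Prop) :
  nearC z P <-> exists d, 0 < d /\ forall y, Cmod (y - z) < d -> P y.
Proof.
  split.
  - intros [d H]; exists d; split; [apply cond_pos|]. intros y Hy; apply H, Hy.
  - intros [d [Hd H]]; exists (mkposreal d Hd). intros y Hy; apply H, Hy.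
Qed.

Lemma Cminus_diag (z : C) : (z - z)%C = 0.
Proof. ring. Qed.

Lemma Cmod_minus_sym (x y : C) : Cmod (x - y) = Cmod (y - x).
Proof. rewrite <- Cmod_opp; f_equal; ring. Qed.

Lemma Cmod_triangle_minus (x y : C) : Cmod x <= Cmod y + Cmod (x - y).
Proof. replace x with (y + (x - y))%C at 1 by ring. apply Cmod_triangle. Qed.

Lemma Cmod_minus_le (x y : C) : Cmod (x - y) <= Cmod x + Cmod y.
Proof.
  replace (x - y)%C with (x + (- y))%C by ring.
  rewrite <- (Cmod_opp y). apply Cmod_triangle.
Qed.

Section Limits.
Context {X : Type} (F : (X -> Prop) -> Prop) {FF : Filter F}.

Lemma Clim_const (c : C) : Clim F (fun _ => c) c.
Proof.
  intros eps Heps. apply filter_imp with (fun _ => True); [|apply filter_true].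
  intros _ _. rewrite Cminus_diag, Cmod_0; exact Heps.
Qed.

Lemma Clim_plus (f g : X -> C) (a b : C) :
  Clim F f a -> Clim F g b -> Clim F (fun x => f x + g x)%C (a + b)%C.
Proof.
  intros Hf Hg eps Heps.
  assert (He : 0 < eps / 2) by lra.
  generalize (filter_and _ _ (Hf _ He) (Hg _ He)).
  apply filter_imp; intros x [H1 H2].
  replace (f x + g x - (a + b))%C with ((f x - a) + (g x - b))%C by ring.
  eapply Rle_lt_trans; [apply Cmod_triangle|lra].
Qed.

Lemma Clim_bounded (f : X -> C) (a : C) :
  Clim F f a -> F (fun x => Cmod (f x) < Cmod a + 1).
Proof.
  intros Hf. generalize (Hf 1 Rlt_0_1). apply filter_imp; intros x Hx.
  pose proof (Cmod_triangle_minus (f x) a); lra.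
Qed.

Lemma Clim_mult (f g : X -> C) (a b : C) :
  Clim F f a -> Clim F g b -> Clim F (fun x => f x * g x)%C (a * b)%C.
Proof.
  intros Hf Hg eps Heps.
  pose proof (Cmod_ge_0 a); pose proof (Cmod_ge_0 b).
  set (B := Cmod a + Cmod b + 1).
  assert (HB : 0 < B) by (unfold B; lra).
  assert (He : 0 < eps / (2 * B)) by (apply Rdiv_lt_0_compat; lra).
  generalize (filter_and _ _ (Clim_bounded f a Hf) (filter_and _ _ (Hf _ He) (Hg _ He))).
  apply filter_imp; intros x [H1 [H2 H3]].
  replace (f x * g x - a * b)%C with (f x * (g x - b) + (f x - a) * b)%C by ring.
  eapply Rle_lt_trans; [apply Cmod_triangle|]. rewrite !Cmod_mult.
  pose proof (Cmod_ge_0 (f x)); pose proof (Cmod_ge_0 (f x - a)); pose proof (Cmod_ge_0 (g x - b)).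
  assert (Cmod (f x) * Cmod (g x - b) <= B * Cmod (g x - b))
    by (apply Rmult_le_compat_r; unfold B; lra).
  assert (Cmod (f x - a) * Cmod b <= Cmod (f x - a) * B)
    by (apply Rmult_le_compat_l; unfold B; lra).
  assert (B * Cmod (g x - b) < eps / 2).
  { replace (eps / 2) with (B * (eps / (2 * B))) by (field; lra).
    apply Rmult_lt_compat_l; lra. }
  assert (Cmod (f x - a) * B < eps / 2).
  { replace (eps / 2) with (eps / (2 * B) * B) by (field; lra).
    apply Rmult_lt_compat_r; lra. }
  lra.
Qed.

Lemma Clim_neq_0 (f : X -> C) (a : C) :
  a <> 0 -> Clim F f a -> F (fun x => Cmod a / 2 < Cmod (f x)).
Proof.
  intros Ha Hf. apply Cmod_gt_0 in Ha.
  assert (He : 0 < Cmod a / 2) by lra.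
  generalize (Hf _ He). apply filter_imp; intros x Hx.
  pose proof (Cmod_triangle_minus a (f x)). rewrite Cmod_minus_sym in Hx. lra.
Qed.

Lemma Clim_inv (f : X -> C) (a : C) :
  a <> 0 -> Clim F f a -> Clim F (fun x => / f x)%C (/ a)%C.
Proof.
  intros Ha Hf eps Heps.
  pose proof Ha as Ha'. apply Cmod_gt_0 in Ha'.
  assert (He : 0 < eps * (Cmod a * Cmod a / 2)) by (apply Rmult_lt_0_compat; nra).
  generalize (filter_and _ _ (Clim_neq_0 f a Ha Hf) (Hf _ He)).
  apply filter_imp; intros x [H1 H2].
  assert (Hfx : f x <> 0) by (apply Cmod_gt_0; lra).
  replace (/ f x - / a)%C with ((a - f x) / (f x * a))%C
    by (field; split; assumption).
  assert (Hm : (f x * a)%C <> 0) by (apply Cmult_neq_0; assumption).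
  rewrite Cmod_div, Cmod_mult, Cmod_minus_sym by exact Hm.
  apply Rlt_div_l; [apply Rmult_lt_0_compat; lra|].
  eapply Rlt_le_trans; [exact H2|]. apply Rmult_le_compat_l; [lra|]. nra.
Qed.

Lemma Clim_ext (f g : X -> C) (a : C) :
  F (fun x => f x = g x) -> Clim F f a -> Clim F g a.
Proof.
  intros He Hf eps Heps. generalize (filter_and _ _ He (Hf eps Heps)).
  apply filter_imp; intros x [<- H]; exact H.
Qed.

Lemma Clim_Cmod_le (f : X -> C) (a : C) (M : R) :
  ProperFilter F -> Clim F f a -> F (fun x => Cmod (f x) <= M) -> Cmod a <= M.
Proof.
  intros PF Hf HM. apply Rnot_lt_le; intros Hlt.
  assert (He : 0 < Cmod a - M) by lra.
  destruct (filter_ex _ (filter_and _ _ HM (Hf _ He))) as [x [H1 H2]].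
  pose proof (Cmod_triangle_minus a (f x)). rewrite Cmod_minus_sym in H2. lra.
Qed.

End Limits.

Lemma filter_le_Clim {X : Type} (F G : (X -> Prop) -> Prop) (f : X -> C) (l : C) :
  filter_le F G -> Clim G f l -> Clim F f l.
Proof. intros H HG eps Heps; apply H, HG, Heps. Qed.

Definition ccont (f : C -> C) (z : C) : Prop := Clim (nearC z) f (f z).

Lemma ccont_id (z : C) : ccont (fun y => y) z.
Proof. intros eps Heps; apply nearC_iff; exists eps; auto. Qed.

Lemma Clim_comp {X : Type} (F : (X -> Prop) -> Prop) {FF : Filter F} (f : X -> C) (g : C -> C) (a : C) :
  Clim F f a -> ccont g a -> Clim F (fun x => g (f x)) (g a).
Proof.
  intros Hf Hg eps Heps.
  destruct (proj1 (nearC_iff _ _) (Hg eps Heps)) as [d [Hd H]].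
  generalize (Hf d Hd). apply filter_imp; intros x Hx. now apply H.
Qed.

(* Caratheodory's form of differentiability: [q] is the difference quotient,
   [q z] the derivative. *)
Definition cdiff (f : C -> C) (z : C) : Prop :=
  exists q : C -> C, (forall y, f y = f z + (y - z) * q y)%C /\ ccont q z.

(** An identity valid only near z suffices: away from z the factor can be replaced by the true
    quotient. *)
Lemma cdiff_intro (f q : C -> C) (z : C) :
  nearC z (fun y => f y = f z + (y - z) * q y)%C -> ccont q z -> cdiff f z.
Proof.
  intros He Hq.
  exists (fun y => if Ceq_dec y z then q z else (f y - f z) / (y - z))%C.
  split.
  - intros y. destruct (Ceq_dec y z) as [->|Hy]; [ring|].
    field. now apply Cminus_eq_contra.
  - unfold ccont. destruct (Ceq_dec z z) as [_|]; [|contradiction].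
    apply Clim_ext with (f := q); [typeclasses eauto| |exact Hq].
    generalize He; apply filter_imp; intros y Hy.
    destruct (Ceq_dec y z) as [->|Hn]; [reflexivity|].
    rewrite Hy. field. now apply Cminus_eq_contra.
Qed.

Lemma cdiff_ext (f g : C -> C) (z : C) :
  nearC z (fun y => f y = g y) -> cdiff f z -> cdiff g z.
Proof.
  intros He [q [H1 H2]]. apply cdiff_intro with q; [|exact H2].
  rewrite <- (nearC_singleton z _ He).
  generalize He; apply filter_imp; intros y <-; apply H1.
Qed.

Lemma cdiff_cont (f : C -> C) (z : C) : cdiff f z -> ccont f z.
Proof.
  intros [q [H1 H2]]. unfold ccont.
  apply Clim_ext with (fun y => f z + (y - z) * q y)%C; [typeclasses eauto| |].
  { apply filter_forall; intros y; symmetry; apply H1. }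
  cut (Clim (nearC z) (fun y => f z + (y - z) * q y)%C (f z + (z + - z) * q z)%C).
  { intros H; replace (f z + (z + - z) * q z)%C with (f z) in H; [exact H|ring]. }
  apply Clim_plus; [typeclasses eauto|apply Clim_const; typeclasses eauto|].
  apply Clim_mult; [typeclasses eauto| |exact H2].
  apply Clim_plus; [typeclasses eauto|apply ccont_id|apply Clim_const; typeclasses eauto].
Qed.

Ltac clim := repeat first
  [ assumption | apply Clim_const | apply Clim_plus | apply Clim_mult | apply ccont_id
  | apply cdiff_cont; assumption | typeclasses eauto ].

Lemma cdiff_const (c z : C) : cdiff (fun _ => c) z.
Proof. exists (fun _ => 0); split; [intros; ring|unfold ccont; clim]. Qed.

Lemma cdiff_id (z : C) : cdiff (fun y => y) z.
Proof. exists (fun _ => 1); split; [intros; ring|unfold ccont; clim]. Qed.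

Lemma cdiff_plus (f g : C -> C) (z : C) :
  cdiff f z -> cdiff g z -> cdiff (fun y => f y + g y)%C z.
Proof.
  intros [p [P1 P2]] [q [Q1 Q2]]. exists (fun y => p y + q y)%C; split.
  - intros y; rewrite P1, Q1; ring.
  - unfold ccont; clim.
Qed.

Lemma cdiff_mult (f g : C -> C) (z : C) :
  cdiff f z -> cdiff g z -> cdiff (fun y => f y * g y)%C z.
Proof.
  intros Hf Hg; pose proof (cdiff_cont f z Hf) as Cf.
  destruct Hf as [p [P1 P2]], Hg as [q [Q1 Q2]].
  exists (fun y => p y * g z + f y * q y)%C; split.
  - intros y; rewrite Q1, (P1 y); ring.
  - unfold ccont; clim.
Qed.

Lemma cdiff_opp (f : C -> C) (z : C) : cdiff f z -> cdiff (fun y => - f y)%C z.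
Proof.
  intros Hf. apply cdiff_ext with (fun y => - (1) * f y)%C.
  { apply filter_forall; intros; ring. }
  apply cdiff_mult; [apply cdiff_const|exact Hf].
Qed.

Lemma cdiff_minus (f g : C -> C) (z : C) :
  cdiff f z -> cdiff g z -> cdiff (fun y => f y - g y)%C z.
Proof. intros Hf Hg; apply cdiff_plus; [exact Hf|now apply cdiff_opp]. Qed.

Lemma cdiff_pow (f : C -> C) (z : C) (n : nat) :
  cdiff f z -> cdiff (fun y => f y ^ n)%C z.
Proof.
  intros Hf; induction n as [|n IH]; simpl; [apply cdiff_const|now apply cdiff_mult].
Qed.

Lemma cdiff_comp (f g : C -> C) (z : C) :
  cdiff f z -> cdiff g (f z) -> cdiff (fun y => g (f y)) z.
Proof.
  intros Hf; pose proof (cdiff_cont f z Hf) as Cf.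
  destruct Hf as [p [P1 P2]]; intros [q [Q1 Q2]].
  exists (fun y => p y * q (f y))%C; split.
  - intros y; rewrite Q1, (P1 y) at 1; ring.
  - unfold ccont. apply Clim_mult; [typeclasses eauto|exact P2|].
    apply Clim_comp with (g := q); [typeclasses eauto|exact Cf|exact Q2].
Qed.

Lemma cdiff_inv (f : C -> C) (z : C) :
  f z <> 0 -> cdiff f z -> cdiff (fun y => / f y)%C z.
Proof.
  intros Hz Hf; pose proof (cdiff_cont f z Hf) as Cf.
  destruct Hf as [p [P1 P2]].
  apply cdiff_intro with (fun y => - (1) * (p y * (/ f y * / f z)))%C.
  - assert (HN := Clim_neq_0 (nearC z) f (f z) Hz Cf).
    generalize HN; apply filter_imp; intros y Hy.
    assert (Hfy : f y <> 0) by (apply Cmod_gt_0; pose proof (Cmod_ge_0 (f z)); lra).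
    apply Ceq_minus.
    replace (/ f y - (/ f z + (y - z) * (- (1) * (p y * (/ f y * / f z)))))%C
      with ((f z + (y - z) * p y - f y) / (f y * f z))%C by (field; split; assumption).
    rewrite <- P1, Cminus_diag. unfold Cdiv; ring.
  - unfold ccont; clim. apply Clim_inv; clim.
Qed.

Lemma cdiff_div (f g : C -> C) (z : C) :
  g z <> 0 -> cdiff f z -> cdiff g z -> cdiff (fun y => f y / g y)%C z.
Proof. intros Hz Hf Hg; apply cdiff_mult; [exact Hf|now apply cdiff_inv]. Qed.

(** The bridge to the notion of analyticity in the statement; everything in between is done with
    [cdiff]. *)
Lemma ex_derive_iff_cdiff (f : C -> C) (z : C) :
  @ex_derive C_AbsRing C_NormedModule f z <-> cdiff f z.
Proof.
  split.
  - intros [l [_ Hl]].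
    specialize (Hl z (fun P H => H)).
    exists (fun y => if Ceq_dec y z then l else (f y - f z) / (y - z))%C.
    split.
    + intros y. destruct (Ceq_dec y z) as [->|Hy]; [ring|].
      field. now apply Cminus_eq_contra.
    + unfold ccont. destruct (Ceq_dec z z) as [_|]; [|contradiction].
      intros eps Heps.
      assert (He2 : 0 < eps / 2) by lra.
      generalize (Hl (mkposreal _ He2)). apply filter_imp; intros y Hy.
      destruct (Ceq_dec y z) as [->|Hn].
      { rewrite Cminus_diag, Cmod_0; exact Heps. }
      change (Cmod (f y - f z - (y - z) * l)%C <= eps / 2 * Cmod (y - z)%C) in Hy.
      assert (Hyz := Cminus_eq_contra _ _ Hn).
      assert (Hp : 0 < Cmod (y - z)) by now apply Cmod_gt_0.
      replace ((f y - f z) / (y - z) - l)%C with ((f y - f z - (y - z) * l) / (y - z))%C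
        by (field; exact Hyz).
      rewrite Cmod_div by exact Hyz.
      apply Rlt_div_l; [exact Hp|]. nra.
  - intros [q [H1 H2]]. exists (q z). split; [apply is_linear_scal_l|].
    intros x Hx.
    assert (x = z).
    { symmetry. apply (is_filter_lim_locally_unique (K := C_AbsRing) (V := AbsRing_NormedModule C_AbsRing)). exact Hx. }
    subst x. intros eps.
    generalize (H2 eps (cond_pos eps)). apply filter_imp; intros y Hy.
    change (Cmod (f y - f z - (y - z) * q z)%C <= eps * Cmod (y - z)%C).
    rewrite (H1 y).
    replace (f z + (y - z) * q y - f z - (y - z) * q z)%C with ((q y - q z) * (y - z))%C by ring.
    rewrite Cmod_mult. apply Rmult_le_compat_r; [apply Cmod_ge_0|lra].
Qed.

(** * The mean value property *)

Lemma im_le_Cmod (z : C) : Rabs (Im z) <= Cmod z.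
Proof.
  eapply Rle_trans; [|apply Rmax_Cmod]. apply Rmax_r.
Qed.

Lemma Cmod_le_Rmax (z : C) : Cmod z <= 2 * Rmax (Rabs (fst z)) (Rabs (snd z)).
Proof.
  eapply Rle_trans; [apply Cmod_2Rmax|].
  apply Rmult_le_compat_r.
  - eapply Rle_trans; [apply Rabs_pos|apply Rmax_l].
  - pose proof (sqrt_sqrt 2 ltac:(lra)); pose proof (sqrt_pos 2); nra.
Qed.

(** With a + i b the derivative, multiplication by a + i b is the real linear map with rows (a, -b)
    and (b, a). *)
Lemma cauchy_riemann (f : C -> C) (x y : R) :
  cdiff f (x, y) -> exists a b,
    differentiable_pt_lim (fun u v => Re (f (u, v))) x y a (- b) /\
    differentiable_pt_lim (fun u v => Im (f (u, v))) x y b a.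
Proof.
  intros [q [H1 H2]]. exists (Re (q (x, y))), (Im (q (x, y))).
  assert (HE : forall eps : posreal, locally_2d (fun u v =>
    Cmod (f (u, v) - f (x, y) - ((u, v) - (x, y)) * q (x, y))%C <=
      eps * Rmax (Rabs (u - x)) (Rabs (v - y))) x y).
  { intros eps. assert (He : 0 < eps / 2) by (pose proof (cond_pos eps); lra).
    destruct (proj1 (nearC_iff _ _) (H2 _ He)) as [d [Hd H]].
    assert (Hd2 : 0 < d / 2) by lra.
    exists (mkposreal _ Hd2). simpl. intros u v Hu Hv.
    set (m := Rmax (Rabs (u - x)) (Rabs (v - y))).
    assert (Hm : Cmod ((u, v) - (x, y))%C <= 2 * m).
    { eapply Rle_trans; [apply Cmod_le_Rmax|]. simpl. unfold m, Rminus. lra. }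
    assert (Hm2 : m < d / 2) by (apply Rmax_lub_lt; assumption).
    rewrite H1.
    replace (f (x, y) + ((u, v) - (x, y)) * q (u, v) - f (x, y) - ((u, v) - (x, y)) * q (x, y))%C
      with ((q (u, v) - q (x, y)) * ((u, v) - (x, y)))%C by ring.
    rewrite Cmod_mult.
    specialize (H (u, v) ltac:(lra)).
    pose proof (Cmod_ge_0 ((u, v) - (x, y))%C). pose proof (Cmod_ge_0 (q (u, v) - q (x, y))%C).
    apply Rle_trans with (eps / 2 * (2 * m)); [|lra].
    apply Rmult_le_compat; lra. }
  split; intros eps; destruct (HE eps) as [d Hd]; exists d; intros u v Hu Hv;
    specialize (Hd u v Hu Hv); (eapply Rle_trans; [|exact Hd]).
  - eapply Rle_trans; [|apply re_le_Cmod]. right; f_equal.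
    unfold Re, Im; simpl. ring.
  - eapply Rle_trans; [|apply im_le_Cmod]. right; f_equal.
    unfold Re, Im; simpl. ring.
Qed.

(** Gives the differentials of the two coordinates of [polar]. *)
Lemma differentiable_pt_lim_mult_separate (f g : R -> R) (x y f' g' : R) :
  derivable_pt_lim f x f' -> derivable_pt_lim g y g' ->
  differentiable_pt_lim (fun u v => f u * g v) x y (f' * g y) (f x * g').
Proof.
  intros Hf Hg.
  assert (HM : forall a b, differentiable_pt_lim Rmult a b b a).
  { intros a b eps. exists eps; intros u v Hu Hv.
    replace (u * v - a * b - (b * (u - a) + a * (v - b))) with ((u - a) * (v - b)) by ring.
    rewrite Rabs_mult.
    apply Rmult_le_compat; try apply Rabs_pos; [lra|apply Rmax_r]. }
  assert (HP : differentiable_pt_lim (fun _ v => g v) x y 0 g').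
  { replace 0 with (g' * 0 + 0 * 0) by ring. replace g' with (g' * 1 + 0 * 0) at 2 by ring.
    apply (differentiable_pt_lim_comp (fun u _ => g u) (fun _ v => v) (fun _ _ => 0)).
    - now apply differentiable_pt_lim_proj1_0.
    - intros eps. exists eps; intros u v Hu Hv.
      replace (v - y - (0 * (u - x) + 1 * (v - y))) with 0 by ring.
      rewrite Rabs_R0. apply Rmult_le_pos; [apply Rlt_le, cond_pos|].
      eapply Rle_trans; [apply Rabs_pos|apply Rmax_l].
    - intros eps. exists eps; intros u v Hu Hv.
      replace (0 - 0 - (0 * (u - x) + 0 * (v - y))) with 0 by ring.
      rewrite Rabs_R0. apply Rmult_le_pos; [apply Rlt_le, cond_pos|].
      eapply Rle_trans; [apply Rabs_pos|apply Rmax_l]. }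
  replace (f' * g y) with (g y * f' + f x * 0) by ring.
  replace (f x * g') with (g y * 0 + f x * g') by ring.
  apply (differentiable_pt_lim_comp Rmult (fun u _ => f u) (fun _ v => g v));
    [apply HM|now apply differentiable_pt_lim_proj1_0|exact HP].
Qed.

(** This is e^(s + i t); the half plane s < 0 covers the punctured unit disc. *)
Definition polar (s t : R) : C := (exp s * cos t, exp s * sin t).

Lemma Cmod_polar (s t : R) : Cmod (polar s t) = exp s.
Proof.
  unfold Cmod, polar; simpl.
  replace (exp s * cos t * (exp s * cos t * 1) + exp s * sin t * (exp s * sin t * 1))
    with (exp s * exp s * (Rsqr (sin t) + Rsqr (cos t))) by (unfold Rsqr; ring).
  rewrite sin2_cos2, Rmult_1_r. apply sqrt_square. left; apply exp_pos.
Qed.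

(* In logarithmic coordinates an annulus is a rectangle whose horizontal sides
   cancel by periodicity, so Goursat's theorem makes circle means independent
   of the radius. *)
Lemma circle_mean_constant (f : C -> C) (s1 s2 : R) :
  s1 <= s2 -> s2 < 0 -> (forall z, Cmod z < 1 -> cdiff f z) ->
  RInt (fun t => Re (f (polar s2 t)) - Re (f (polar s1 t))) 0 (2 * PI) = 0.
Proof.
  intros Hs Hs2 Hf.
  assert (HPI := PI_RGT_0).
  (* The form is Im F ds + Re F dt, the imaginary part of F(zeta) d zeta for zeta = s + i t and F =
     f o exp; it is closed by the Cauchy-Riemann equations and the chain rule. *)
  assert (HG : circulation (fun s t => Im (f (polar s t))) (fun s t => Re (f (polar s t)))
    s1 s2 0 (2 * PI) = 0).
  { apply goursat; [exact Hs|lra|].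
    intros s t Hs' Ht.
    destruct (cauchy_riemann f (exp s * cos t) (exp s * sin t)) as [a [b [H1 H2]]].
    { apply Hf. change (Cmod (polar s t) < 1). rewrite Cmod_polar.
      rewrite <- exp_0. apply exp_increasing; lra. }
    assert (HX := differentiable_pt_lim_mult_separate exp cos s t _ _
      (derivable_pt_lim_exp s) (derivable_pt_lim_cos t)).
    assert (HY := differentiable_pt_lim_mult_separate exp sin s t _ _
      (derivable_pt_lim_exp s) (derivable_pt_lim_sin t)).
    assert (D1 := differentiable_pt_lim_comp _ _ _ _ _ _ _ _ _ _ _ H1 HX HY).
    assert (D2 := differentiable_pt_lim_comp _ _ _ _ _ _ _ _ _ _ _ H2 HX HY).
    eexists _, _, _; split; [exact D2|].
    match type of D1 with differentiable_pt_lim _ _ _ ?u _ =>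
      match type of D2 with differentiable_pt_lim _ _ _ _ ?v =>
        replace v with u by ring end end.
    exact D1. }
  unfold circulation in HG.
  assert (E : RInt (fun x => Im (f (polar x 0)) - Im (f (polar x (2 * PI)))) s1 s2 = 0).
  { rewrite (RInt_ext _ (fun _ => 0)).
    - rewrite RInt_const. apply Rmult_0_r.
    - intros x _. unfold polar. rewrite cos_2PI, sin_2PI, cos_0, sin_0. simpl. ring. }
  rewrite E, Rplus_0_l in HG. exact HG.
Qed.

(** The mean of Re f over the circle of radius r is also its mean over an arbitrarily small circle,
    where Re f is close to Re (f 0). If Re (f 0) > M, the difference of the two integrands would be
    positive everywhere although its integral is 0. *)
Lemma Re_center_le (f : C -> C) (r M : R) :
  0 < r < 1 -> (forall z, Cmod z < 1 -> cdiff f z) ->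
  (forall z, Cmod z = r -> Re (f z) <= M) -> Re (f 0) <= M.
Proof.
  intros Hr Hf HM. assert (HPI := PI_RGT_0).
  apply Rnot_lt_le; intros Hlt.
  set (eps := Re (f 0) - M). assert (Heps : 0 < eps) by (unfold eps; lra).
  assert (C0 : ccont f 0) by (apply cdiff_cont, Hf; rewrite Cmod_0; lra).
  destruct (proj1 (nearC_iff _ _) (C0 eps Heps)) as [d [Hd H]].
  set (s1 := ln (Rmin r (d / 2))).
  assert (Hm : 0 < Rmin r (d / 2)) by (apply Rmin_pos; lra).
  assert (E1 : exp s1 = Rmin r (d / 2)) by (unfold s1; now apply exp_ln).
  assert (E2 : exp (ln r) = r) by (apply exp_ln; lra).
  pose proof (Rmin_l r (d / 2)); pose proof (Rmin_r r (d / 2)).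
  assert (L : s1 <= ln r).
  { destruct (Rle_lt_dec s1 (ln r)) as [|Hl]; [assumption|].
    apply exp_increasing in Hl. lra. }
  assert (Ln : ln r < 0) by (rewrite <- ln_1; apply ln_increasing; lra).
  assert (HC := circle_mean_constant f s1 (ln r) L Ln Hf).
  assert (Hcont : forall s t, s <= ln r -> continuous (fun t => Re (f (polar s t))) t).
  { intros s t Hs.
    destruct (cauchy_riemann f (exp s * cos t) (exp s * sin t)) as [a [b [H1' _]]].
    { apply Hf. change (Cmod (polar s t) < 1). rewrite Cmod_polar.
      rewrite <- exp_0. apply exp_increasing; lra. }
    assert (HX := differentiable_pt_lim_mult_separate exp cos s t _ _
      (derivable_pt_lim_exp s) (derivable_pt_lim_cos t)).
    assert (HY := differentiable_pt_lim_mult_separate exp sin s t _ _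
      (derivable_pt_lim_exp s) (derivable_pt_lim_sin t)).
    assert (D1 := differentiable_pt_lim_comp _ _ _ _ _ _ _ _ _ _ _ H1' HX HY).
    apply differentiable_pt_lim_continuity in D1.
    apply filterlim_locally; intros e. destruct (D1 e) as [dd HD].
    exists dd; intros y Hy. apply HD; [|exact Hy].
    rewrite Rminus_diag, Rabs_R0; apply cond_pos. }
  assert (Hneg : RInt (fun t => Re (f (polar s1 t)) - Re (f (polar (ln r) t))) 0 (2 * PI) > 0).
  { apply RInt_gt_0; [lra| |].
    - intros t Ht.
      assert (A := HM (polar (ln r) t)). rewrite Cmod_polar in A. specialize (A E2).
      assert (B : Cmod (f (polar s1 t) - f 0) < eps).
      { apply H. replace (polar s1 t - 0)%C with (polar s1 t) by ring.
        rewrite Cmod_polar. lra. }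
      pose proof (re_le_Cmod (f (polar s1 t) - f 0)%C) as D.
      apply Rabs_le_between in D.
      replace (Re (f (polar s1 t) - f 0)%C) with (Re (f (polar s1 t)) - Re (f 0)) in D
        by (unfold Re; simpl; ring).
      unfold eps in *; lra.
    - intros t Ht. apply (@continuous_minus R_UniformSpace R_AbsRing R_NormedModule); apply Hcont; lra. }
  rewrite (RInt_ext _ (fun t => opp (Re (f (polar (ln r) t)) - Re (f (polar s1 t))))) in Hneg
    by (intros; unfold opp; simpl; ring).
  rewrite (RInt_opp (V := R_CompleteNormedModule)) in Hneg.
  - rewrite HC in Hneg. unfold opp in Hneg; simpl in Hneg; lra.
  - apply (@ex_RInt_continuous R_CompleteNormedModule). intros t _.
    apply (@continuous_minus R_UniformSpace R_AbsRing R_NormedModule); apply Hcont; lra.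
Qed.

(** * Moebius maps and the maximum principle *)

(** The sign is chosen so that 0 goes to a; the inverse is then [mob (- a)]. *)
Definition mob (a z : C) : C := ((z + a) / (1 + Cconj a * z))%C.

Lemma one_plus_neq_0 (z : C) : Cmod z < 1 -> (1 + z)%C <> 0.
Proof.
  intros H E. assert (E' : z = (- (1))%C) by (apply Ceq_minus; rewrite <- E; ring).
  rewrite E', Cmod_m1 in H. lra.
Qed.

Lemma mob_den_small (a z : C) : Cmod a < 1 -> Cmod z <= 1 -> Cmod (Cconj a * z) < 1.
Proof.
  intros Ha Hz. rewrite Cmod_mult, Cmod_conj.
  pose proof (Cmod_ge_0 a); pose proof (Cmod_ge_0 z). nra.
Qed.

Lemma mob_den (a z : C) : Cmod a < 1 -> Cmod z <= 1 -> (1 + Cconj a * z)%C <> 0.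
Proof. intros Ha Hz. apply one_plus_neq_0, mob_den_small; assumption. Qed.

Lemma mob_identity (a z : C) :
  Cmod (1 + Cconj a * z) ^ 2 = Cmod (z + a) ^ 2 + (1 - Cmod a ^ 2) * (1 - Cmod z ^ 2).
Proof. rewrite !Cmod2_alt. unfold Re, Im; simpl. ring. Qed.

(** [mob_identity] divided by the squared denominator. The sign of 1 - |z|^2 decides whether the
    image is inside the disc, and its size how near to the circle. *)
Lemma Cmod_mob (a z : C) : Cmod a < 1 -> Cmod z <= 1 ->
  (1 - Cmod (mob a z) ^ 2) * Cmod (1 + Cconj a * z) ^ 2 = (1 - Cmod a ^ 2) * (1 - Cmod z ^ 2).
Proof.
  intros Ha Hz. pose proof (mob_den a z Ha Hz) as Hd. unfold mob.
  rewrite Cmod_div by exact Hd. apply Cmod_gt_0 in Hd.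
  pose proof (mob_identity a z).
  replace ((1 - (Cmod (z + a) / Cmod (1 + Cconj a * z)) ^ 2) * Cmod (1 + Cconj a * z) ^ 2)
    with (Cmod (1 + Cconj a * z) ^ 2 - Cmod (z + a) ^ 2) by (field; lra).
  lra.
Qed.

Lemma mob_disc (a z : C) : Cmod a < 1 -> Cmod z < 1 -> Cmod (mob a z) < 1.
Proof.
  intros Ha Hz. pose proof (Cmod_mob a z Ha ltac:(lra)) as H.
  pose proof (mob_den a z Ha ltac:(lra)) as Hd. apply Cmod_gt_0 in Hd.
  pose proof (Cmod_ge_0 a); pose proof (Cmod_ge_0 z); pose proof (Cmod_ge_0 (mob a z)).
  assert (0 < (1 - Cmod a ^ 2) * (1 - Cmod z ^ 2)) by (apply Rmult_lt_0_compat; nra).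
  assert (0 < Cmod (1 + Cconj a * z) ^ 2) by (apply pow_lt; lra).
  rewrite <- H in H3.
  apply Rnot_le_lt; intros Hn.
  assert (1 - Cmod (mob a z) ^ 2 <= 0) by nra. nra.
Qed.

Lemma mob_closed_disc (a z : C) : Cmod a < 1 -> Cmod z <= 1 -> Cmod (mob a z) <= 1.
Proof.
  intros Ha Hz. pose proof (Cmod_mob a z Ha ltac:(lra)) as H.
  pose proof (mob_den a z Ha ltac:(lra)) as Hd. apply Cmod_gt_0 in Hd.
  pose proof (Cmod_ge_0 a); pose proof (Cmod_ge_0 z); pose proof (Cmod_ge_0 (mob a z)).
  assert (0 <= (1 - Cmod a ^ 2) * (1 - Cmod z ^ 2)) by (apply Rmult_le_pos; nra).
  assert (0 < Cmod (1 + Cconj a * z) ^ 2) by (apply pow_lt; lra).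
  rewrite <- H in H3.
  apply Rnot_lt_le; intros Hn.
  assert (1 - Cmod (mob a z) ^ 2 < 0) by nra. nra.
Qed.

Lemma mob_0 (a : C) : mob a 0 = a.
Proof. unfold mob. replace (1 + Cconj a * 0)%C with (RtoC 1) by ring. field. Qed.

Lemma mob_inv (a z : C) : Cmod a < 1 -> Cmod z <= 1 -> mob (- a) (mob a z) = z.
Proof.
  intros Ha Hz. pose proof (mob_den a z Ha Hz) as Hd.
  assert (Hd2 : (1 - Cconj a * a)%C <> 0).
  { replace (1 - Cconj a * a)%C with (1 + Cconj (- a) * a)%C by (rewrite Copp_conj; ring).
    apply mob_den; [now rewrite Cmod_opp|lra]. }
  unfold mob. rewrite Copp_conj.
  assert (E : (1 + - Cconj a * ((z + a) / (1 + Cconj a * z)))%C =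
    ((1 - Cconj a * a) / (1 + Cconj a * z))%C) by (field; exact Hd).
  rewrite E. field. split; assumption.
Qed.

Lemma mob_inv' (a z : C) : Cmod a < 1 -> Cmod z <= 1 -> mob a (mob (- a) z) = z.
Proof.
  intros Ha Hz. replace a with (- - a)%C at 1 by ring.
  apply mob_inv; [now rewrite Cmod_opp|exact Hz].
Qed.

Lemma cdiff_mob (a z : C) : Cmod a < 1 -> Cmod z <= 1 -> cdiff (mob a) z.
Proof.
  intros Ha Hz. unfold mob. apply cdiff_div; [now apply mob_den| |];
    repeat first [apply cdiff_plus | apply cdiff_mult | apply cdiff_id | apply cdiff_const].
Qed.

(** The denominator is at least 1 - |a| in modulus, so by [Cmod_mob] the image of a point near the
    circle is near the circle. This carries boundary estimates along when an interior point is moved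
    to the centre. *)
Lemma mob_annulus (a : C) (r0 : R) : Cmod a < 1 -> r0 < 1 ->
  exists r1, r1 < 1 /\ forall z, r1 < Cmod z < 1 -> r0 < Cmod (mob a z) < 1.
Proof.
  intros Ha Hr. pose proof (Cmod_ge_0 a) as Ha0.
  set (s := Rmax r0 0).
  assert (Hs : r0 <= s /\ 0 <= s < 1).
  { unfold s; split; [apply Rmax_l|split; [apply Rmax_r|apply Rmax_lub_lt; lra]]. }
  set (m := 1 - Cmod a). assert (Hm : 0 < m) by (unfold m; lra).
  (* From |z| > 1 - e follows 1 - |z|^2 < 2 e, and 2 e = (1 - s^2) m^2 is what an image of modulus
     at most s would need at least. *)
  set (e := (1 - s ^ 2) * m ^ 2 / 2).
  assert (He : 0 < e) by (unfold e; assert (0 < m ^ 2) by (apply pow_lt; lra);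
    assert (0 < 1 - s ^ 2) by nra; nra).
  exists (1 - e); split; [lra|].
  intros z Hz. split; [|apply mob_disc; lra].
  apply Rle_lt_trans with s; [lra|].
  pose proof (Cmod_mob a z Ha ltac:(lra)) as H.
  pose proof (Cmod_ge_0 z); pose proof (Cmod_ge_0 (mob a z)).
  assert (Hden : m <= Cmod (1 + Cconj a * z)).
  { pose proof (Cmod_triangle_minus 1 (1 + Cconj a * z)) as T.
    replace (1 - (1 + Cconj a * z))%C with (- (Cconj a * z))%C in T by ring.
    rewrite Cmod_1, Cmod_opp, Cmod_mult, Cmod_conj in T. unfold m. nra. }
  assert (Hden2 : m ^ 2 <= Cmod (1 + Cconj a * z) ^ 2) by (apply pow_incr; lra).
  assert (Hm2 : 0 < m ^ 2) by (apply pow_lt; lra).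
  apply Rnot_le_lt; intros Hn.
  assert (A : 1 - s ^ 2 <= 1 - Cmod (mob a z) ^ 2) by nra.
  assert (B : (1 - Cmod a ^ 2) * (1 - Cmod z ^ 2) < 2 * e).
  { assert (0 <= 1 - Cmod a ^ 2 <= 1) by nra.
    assert (1 - Cmod z ^ 2 < 2 * e) by nra.
    assert (0 <= 1 - Cmod z ^ 2) by nra. nra. }
  assert (Cc : (1 - s ^ 2) * m ^ 2 <= (1 - Cmod (mob a z) ^ 2) * Cmod (1 + Cconj a * z) ^ 2)
    by (apply Rmult_le_compat; nra).
  unfold e in B. lra.
Qed.

Definition analytic (f : C -> C) : Prop := forall z, Cmod z < 1 -> cdiff f z.

Lemma analytic_mob (f : C -> C) (a : C) :
  Cmod a < 1 -> analytic f -> analytic (fun z => f (mob a z)).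
Proof.
  intros Ha Hf z Hz. apply (cdiff_comp (mob a) f); [apply cdiff_mob; lra|].
  apply Hf, mob_disc; assumption.
Qed.

(** [mob w] moves w to the centre, and a unimodular factor u with u f(w) = |f(w)| turns the bound
    for the real part into one for the modulus. The hypothesis speaks of an annulus only, so no
    boundary values are needed. *)
Lemma max_principle (f : C -> C) (M r0 : R) :
  analytic f -> r0 < 1 -> (forall z, r0 < Cmod z < 1 -> Cmod (f z) <= M) ->
  forall w, Cmod w < 1 -> Cmod (f w) <= M.
Proof.
  intros Hf Hr HM w Hw.
  destruct (mob_annulus w r0 Hw Hr) as [r1 [Hr1 H1]].
  destruct (Ceq_dec (f w) 0) as [E|E].
  - rewrite E, Cmod_0.
    set (x := (Rmax r0 0 + 1) / 2).
    assert (Hx : r0 < x < 1 /\ 0 <= x).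
    { unfold x. pose proof (Rmax_l r0 0); pose proof (Rmax_r r0 0).
      assert (Rmax r0 0 < 1) by (apply Rmax_lub_lt; lra). lra. }
    apply Rle_trans with (Cmod (f (RtoC x))); [apply Cmod_ge_0|].
    apply HM. rewrite Cmod_R, Rabs_pos_eq; lra.
  - apply Cmod_gt_0 in E.
    set (u := (Cconj (f w) / Cmod (f w))%C).
    assert (EC : RtoC (Cmod (f w)) <> 0) by (intros H; apply RtoC_inj in H; lra).
    assert (Hu : Cmod u = 1).
    { unfold u. rewrite Cmod_div, Cmod_conj, Cmod_R, Rabs_pos_eq by (assumption || lra).
      field; lra. }
    assert (Huf : (u * f w)%C = Cmod (f w)).
    { unfold u. replace (Cconj (f w) / Cmod (f w) * f w)%C
        with ((f w * Cconj (f w)) / Cmod (f w))%C by (field; exact EC).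
      rewrite <- Cmod2_conj. simpl. rewrite Rmult_1_r, RtoC_mult. field. exact EC. }
    set (r := (Rmax r1 0 + 1) / 2).
    assert (Hrr : r1 < r < 1 /\ 0 < r).
    { unfold r. pose proof (Rmax_l r1 0); pose proof (Rmax_r r1 0).
      assert (Rmax r1 0 < 1) by (apply Rmax_lub_lt; lra). lra. }
    assert (HR := Re_center_le (fun z => u * f (mob w z))%C r M ltac:(lra)).
    cbv beta in HR. rewrite mob_0, Huf in HR. apply HR.
    + intros z Hz. apply cdiff_mult; [apply cdiff_const|].
      now apply (analytic_mob f w Hw Hf).
    + intros z Hz. eapply Rle_trans; [apply Rle_abs|].
      eapply Rle_trans; [apply re_le_Cmod|].
      rewrite Cmod_mult, Hu, Rmult_1_l. apply HM, H1. lra.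
Qed.

Lemma pow_unbounded_contra (A B q : R) : 0 < A -> 1 < q ->
  (forall n, A * q ^ n <= B) -> False.
Proof.
  intros HA Hq H.
  destruct (Pow_x_infinity q) with (b := (B + 1) / A) as [N HN].
  { rewrite Rabs_pos_eq; lra. }
  specialize (HN N (Nat.le_refl N)). specialize (H N).
  rewrite Rabs_pos_eq in HN by (apply pow_le; lra).
  apply Rge_le in HN. apply Rle_div_l in HN; [|lra]. lra.
Qed.

(* [p] vanishes at the exceptional points, so p^2 f^n is differentiable there;
   the constants disappear by letting n go to infinity. *)
Lemma max_principle_exceptional (f p : C -> C) (K M r0 : R) :
  analytic p -> (forall z, Cmod z < 1 -> Cmod (p z) <= K) ->
  (forall z, Cmod z < 1 -> p z <> 0 -> cdiff f z) ->
  (forall z, Cmod z < 1 -> p z = 0 -> exists B, nearC z (fun y => Cmod (f y) <= B)) ->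
  r0 < 1 -> (forall z, r0 < Cmod z < 1 -> Cmod (f z) <= M) ->
  forall w, Cmod w < 1 -> p w <> 0 -> Cmod (f w) <= M.
Proof.
  intros Hp HK Hf HB Hr HM w Hw Hpw.
  apply Rnot_lt_le; intros Hlt.
  assert (HM0 : 0 <= M).
  { set (x := (Rmax r0 0 + 1) / 2).
    assert (Hx : r0 < x < 1 /\ 0 <= x).
    { unfold x. pose proof (Rmax_l r0 0); pose proof (Rmax_r r0 0).
      assert (Rmax r0 0 < 1) by (apply Rmax_lub_lt; lra). lra. }
    apply Rle_trans with (Cmod (f (RtoC x))); [apply Cmod_ge_0|].
    apply HM. rewrite Cmod_R, Rabs_pos_eq; lra. }
  (* Unlike M, this bound is positive, so |f w| / N is defined and exceeds 1. *)
  set (N := (M + Cmod (f w)) / 2).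
  assert (HN : M < N /\ 0 < N < Cmod (f w)) by (unfold N; lra).
  assert (HK0 : 0 <= K) by (eapply Rle_trans; [apply Cmod_ge_0|apply (HK w Hw)]).
  (* At a zero z of p with quotient q, the function p^2 f^n has the quotient p q f^n, which tends to
     0 because f is bounded near z. *)
  assert (Hg : forall n, analytic (fun z => p z * p z * f z ^ n)%C).
  { intros n z Hz. destruct (Ceq_dec (p z) 0) as [E|E].
    - destruct (HB z Hz E) as [B HBz].
      destruct (Hp z Hz) as [q [Q1 Q2]].
      exists (fun y => p y * (q y * f y ^ n))%C. split.
      + intros y. rewrite (Q1 y) at 1. rewrite E. ring.
      + unfold ccont. rewrite E, Cmult_0_l. intros eps Heps.
        assert (HB0 : 0 <= B) by (eapply Rle_trans; [apply Cmod_ge_0|apply (nearC_singleton _ _ HBz)]).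
        assert (HBn : 0 <= B ^ n) by now apply pow_le.
        set (L := (Cmod (q z) + 1) * B ^ n + 1).
        pose proof (Cmod_ge_0 (q z)).
        assert (HL : 0 < L) by (unfold L; nra).
        assert (He : 0 < eps / L) by now apply Rdiv_lt_0_compat.
        pose proof (cdiff_cont p z (Hp z Hz) _ He) as Cp.
        generalize (filter_and _ _ Cp (filter_and _ _ HBz (Clim_bounded _ _ _ Q2))).
        apply filter_imp. intros y [Y1 [Y2 Y3]].
        rewrite E in Y1.
        replace (p y * (q y * f y ^ n) - 0)%C with ((p y - 0) * (q y * f y ^ n))%C by ring.
        rewrite !Cmod_mult, Cmod_pow.
        assert (Cmod (f y) ^ n <= B ^ n) by (apply pow_incr; split; [apply Cmod_ge_0|exact Y2]).
        assert (0 <= Cmod (f y) ^ n) by (apply pow_le, Cmod_ge_0).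
        pose proof (Cmod_ge_0 (q y)); pose proof (Cmod_ge_0 (p y - 0)).
        assert (Cmod (q y) * Cmod (f y) ^ n <= L) by (unfold L; nra).
        apply Rle_lt_trans with (Cmod (p y - 0) * L).
        { apply Rmult_le_compat_l; assumption. }
        apply Rlt_div_r; assumption.
    - pose proof (Hp z Hz); pose proof (Hf z Hz E).
      repeat first [apply cdiff_mult | apply cdiff_pow | assumption]. }
  apply (pow_unbounded_contra (Cmod (p w) ^ 2) (K ^ 2) (Cmod (f w) / N)).
  - apply pow_lt. now apply Cmod_gt_0.
  - apply Rlt_div_r; lra.
  - intros n.
    assert (Hb := max_principle _ (K ^ 2 * N ^ n) r0 (Hg n) Hr).
    assert (Hw' : Cmod (p w * p w * f w ^ n) <= K ^ 2 * N ^ n).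
    { apply Hb; [|exact Hw]. intros z Hz.
      rewrite !Cmod_mult, Cmod_pow.
      apply Rmult_le_compat.
      - apply Rmult_le_pos; apply Cmod_ge_0.
      - apply pow_le, Cmod_ge_0.
      - pose proof (HK z ltac:(lra)); pose proof (Cmod_ge_0 (p z)). simpl; nra.
      - apply pow_incr; split; [apply Cmod_ge_0|]. pose proof (HM z Hz); lra. }
    rewrite !Cmod_mult, Cmod_pow in Hw'.
    unfold Rdiv; rewrite Rpow_mult_distr, pow_inv.
    replace (Cmod (p w) ^ 2 * (Cmod (f w) ^ n * / N ^ n)) with
      (Cmod (p w) * Cmod (p w) * Cmod (f w) ^ n / N ^ n) by (unfold Rdiv; ring).
    apply Rle_div_l; [apply pow_lt; lra|exact Hw'].
Qed.

(** * Removable singularities *)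

Lemma nearC_punctured_ex (z : C) (P : C -> Prop) : nearC z P -> exists y, y <> z /\ P y.
Proof.
  intros H. destruct (proj1 (nearC_iff _ _) H) as [d [Hd HP]].
  assert (E : (z + RtoC (d / 2) - z)%C = RtoC (d / 2)) by ring.
  exists (z + RtoC (d / 2))%C; split.
  - intros Heq. rewrite Heq, Cminus_diag in E. apply RtoC_inj in E. lra.
  - apply HP. rewrite E, Cmod_R, Rabs_pos_eq; lra.
Qed.

Definition nearC' (z : C) : (C -> Prop) -> Prop := within (fun y => y <> z) (nearC z).

Global Instance nearC'_filter (z : C) : ProperFilter (nearC' z).
Proof.
  constructor; [|apply within_filter; typeclasses eauto].
  intros P HP. destruct (nearC_punctured_ex z _ HP) as [y [H1 H2]]. exists y; auto.
Qed.

Lemma nearC_neq (z w : C) : z <> w -> nearC z (fun y => y <> w).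
Proof.
  intros H. apply nearC_iff. exists (Cmod (z - w)); split.
  - apply Cmod_gt_0. now apply Cminus_eq_contra.
  - intros y Hy E. rewrite E, Cmod_minus_sym in Hy. lra.
Qed.

Lemma nearC_Cmod_lt (z : C) (r : R) : Cmod z < r -> nearC z (fun y => Cmod y < r).
Proof.
  intros H. apply nearC_iff. exists (r - Cmod z); split; [lra|].
  intros y Hy. pose proof (Cmod_triangle_minus y z). lra.
Qed.

Lemma Clim_cauchy {X : Type} (F : (X -> Prop) -> Prop) {FF : ProperFilter F} (f : X -> C) :
  (forall eps, 0 < eps -> exists P, F P /\ forall x y, P x -> P y -> Cmod (f x - f y) < eps) ->
  exists l, Clim F f l.
Proof.
  intros H.
  destruct (proj1 (filterlim_locally_cauchy (U := R_CompleteSpace) (F := F) (fun x => Re (f x))))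
    as [a Ha].
  { intros eps. destruct (H eps (cond_pos eps)) as [P [H1 H2]]. exists P; split; [exact H1|].
    intros x y Hx Hy. change (Rabs (Re (f y) - Re (f x)) < eps).
    eapply Rle_lt_trans; [|apply (H2 y x Hy Hx)].
    eapply Rle_trans; [|apply re_le_Cmod]. right; reflexivity. }
  destruct (proj1 (filterlim_locally_cauchy (U := R_CompleteSpace) (F := F) (fun x => Im (f x))))
    as [b Hb].
  { intros eps. destruct (H eps (cond_pos eps)) as [P [H1 H2]]. exists P; split; [exact H1|].
    intros x y Hx Hy. change (Rabs (Im (f y) - Im (f x)) < eps).
    eapply Rle_lt_trans; [|apply (H2 y x Hy Hx)].
    eapply Rle_trans; [|apply im_le_Cmod]. right; reflexivity. }
  exists (a, b). intros eps Heps.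
  assert (He : 0 < eps / 2) by lra.
  generalize (filter_and _ _ (proj1 (filterlim_locally _ _) Ha (mkposreal _ He))
    (proj1 (filterlim_locally _ _) Hb (mkposreal _ He))).
  apply filter_imp. intros x [H1 H2].
  change (Rabs (Re (f x) - a) < eps / 2) in H1.
  change (Rabs (Im (f x) - b) < eps / 2) in H2.
  eapply Rle_lt_trans; [apply Cmod_le_Rmax|].
  assert (Rmax (Rabs (fst (f x - (a, b))%C)) (Rabs (snd (f x - (a, b))%C)) < eps / 2).
  { apply Rmax_lub_lt; [exact H1|exact H2]. }
  lra.
Qed.

(** Supplies the local bound that [max_principle_exceptional] demands at the points where
    differentiability is unknown. *)
Lemma difference_quotient_locally_bounded (q : C -> C) (w z : C) :
  cdiff q w -> ccont q z ->
  exists B, nearC z (fun y => Cmod ((q y - q w) / (y - w)) <= B).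
Proof.
  intros Hw Hz. destruct (Ceq_dec z w) as [->|E].
  - destruct Hw as [d [D1 D2]]. pose proof (Cmod_ge_0 (d w)).
    exists (Cmod (d w) + 1).
    generalize (Clim_bounded _ _ _ D2). apply filter_imp. intros y Hy.
    destruct (Ceq_dec y w) as [->|Hn].
    + replace ((q w - q w) / (w - w))%C with (RtoC 0) by (unfold Cdiv; ring).
      rewrite Cmod_0; lra.
    + rewrite (D1 y). replace ((q w + (y - w) * d y - q w) / (y - w))%C with (d y)
        by (field; now apply Cminus_eq_contra). lra.
  - assert (L : Clim (nearC z) (fun y => (q y - q w) / (y - w))%C ((q z - q w) / (z - w))%C).
    { apply Clim_mult; [typeclasses eauto| |].
      - apply Clim_plus; clim.
      - apply Clim_inv; [typeclasses eauto|now apply Cminus_eq_contra|].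
        apply Clim_plus; clim. }
    exists (Cmod ((q z - q w) / (z - w)) + 1).
    generalize (Clim_bounded _ _ _ L). apply filter_imp. intros y Hy; lra.
Qed.

(* The difference quotients at w and w' are compared by the maximum principle in
   the variable z; at z = 0 this says that the quotients at 0 are Cauchy. *)
Lemma continuous_singularity_0 (q : C -> C) (B : R) :
  (forall z, Cmod z < 1 -> z <> 0 -> cdiff q z) ->
  ccont q 0 -> (forall z, Cmod z < 1 -> Cmod (q z) <= B) -> cdiff q 0.
Proof.
  intros Hd Hc HB.
  assert (HB0 : 0 <= B) by (eapply Rle_trans; [apply Cmod_ge_0|apply (HB 0); rewrite Cmod_0; lra]).
  assert (Hcont : forall z, Cmod z < 1 -> ccont q z).
  { intros z Hz. destruct (Ceq_dec z 0) as [->|E]; [exact Hc|]. now apply cdiff_cont, Hd. }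
  set (D := fun w z => ((q z - q w) / (z - w))%C).
  (* For |w|, |w'| < 1/4 and |z| > 1/2 both denominators are at least 1/4 in modulus, and the
     combined numerator is at most twice the bracket: hence 32 = 2 * 16. The exceptional points 0,
     w, w' are the zeros of the cubic, which is at most 1 * 2 * 2 on the disc. *)
  assert (Key : forall w w' z : C, Cmod w < / 4 -> Cmod w' < / 4 -> w <> 0 -> w' <> 0 ->
    Cmod z < 1 -> z <> 0 -> z <> w -> z <> w' ->
    Cmod (D w z - D w' z) <= 32 * (B * Cmod (w - w') + Cmod (q w - q w'))).
  { intros w w' z Hw Hw' Nw Nw' Hz N0 N1 N2.
    apply (max_principle_exceptional (fun z => D w z - D w' z)%C
      (fun z => z * ((z - w) * (z - w')))%C 4 _ (/ 2)); try assumption; try lra.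
    - intros y _. repeat first [apply cdiff_mult | apply cdiff_minus | apply cdiff_id | apply cdiff_const].
    - intros y Hy. rewrite !Cmod_mult.
      pose proof (Cmod_ge_0 y); pose proof (Cmod_ge_0 (y - w)); pose proof (Cmod_ge_0 (y - w')).
      pose proof (Cmod_minus_le y w); pose proof (Cmod_minus_le y w').
      assert (Cmod (y - w) * Cmod (y - w') <= 2 * 2) by (apply Rmult_le_compat; lra).
      assert (0 <= Cmod (y - w) * Cmod (y - w')) by (apply Rmult_le_pos; lra). nra.
    - intros y Hy Hp.
      assert (y <> 0) by (intros ->; apply Hp; ring).
      assert (y <> w) by (intros ->; apply Hp; ring).
      assert (y <> w') by (intros ->; apply Hp; ring).
      unfold D. apply cdiff_minus; (apply cdiff_div; [now apply Cminus_eq_contra| |]);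
        apply cdiff_minus; try apply cdiff_const; try apply cdiff_id; now apply Hd.
    - intros y Hy _.
      destruct (difference_quotient_locally_bounded q w y) as [B1 H1];
        [apply Hd; [lra|assumption]|now apply Hcont|].
      destruct (difference_quotient_locally_bounded q w' y) as [B2 H2];
        [apply Hd; [lra|assumption]|now apply Hcont|].
      exists (B1 + B2). generalize (filter_and _ _ H1 H2). apply filter_imp. intros x [X1 X2].
      eapply Rle_trans; [apply Cmod_minus_le|]. unfold D; lra.
    - intros y Hy.
      assert (A1 : / 4 <= Cmod (y - w)) by (pose proof (Cmod_triangle_minus y w); lra).
      assert (A2 : / 4 <= Cmod (y - w')) by (pose proof (Cmod_triangle_minus y w'); lra).
      assert (Z1 : (y - w)%C <> 0) by (apply Cmod_gt_0; lra).
      assert (Z2 : (y - w')%C <> 0) by (apply Cmod_gt_0; lra).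
      assert (E : (D w y - D w' y)%C =
        (((q y - q w) * (w - w') - (q w - q w') * (y - w)) / ((y - w) * (y - w')))%C)
        by (unfold D; field; split; assumption).
      rewrite E, Cmod_div, Cmod_mult by now apply Cmult_neq_0.
      assert (N : Cmod ((q y - q w) * (w - w') - (q w - q w') * (y - w))
        <= 2 * (B * Cmod (w - w') + Cmod (q w - q w'))).
      { eapply Rle_trans; [apply Cmod_minus_le|]. rewrite !Cmod_mult.
        pose proof (Cmod_minus_le (q y) (q w)). pose proof (HB y ltac:(lra)).
        pose proof (HB w ltac:(lra)). pose proof (Cmod_minus_le y w).
        pose proof (Cmod_ge_0 (w - w')); pose proof (Cmod_ge_0 (q w - q w')).
        assert (Cmod (q y - q w) * Cmod (w - w') <= 2 * B * Cmod (w - w'))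
          by (apply Rmult_le_compat_r; lra).
        assert (Cmod (q w - q w') * Cmod (y - w) <= Cmod (q w - q w') * 2)
          by (apply Rmult_le_compat_l; lra). lra. }
      assert (A3 : / 16 <= Cmod (y - w) * Cmod (y - w')) by nra.
      apply Rle_div_l; [lra|].
      assert (0 <= B * Cmod (w - w') + Cmod (q w - q w')).
      { apply Rplus_le_le_0_compat; [apply Rmult_le_pos; [lra|apply Cmod_ge_0]|apply Cmod_ge_0]. }
      nra.
    - repeat apply Cmult_neq_0; try apply Cminus_eq_contra; assumption. }
  (* The point 0 is itself exceptional, so the estimate reaches it by continuity in z. *)
  assert (Key0 : forall w w' : C, Cmod w < / 4 -> Cmod w' < / 4 -> w <> 0 -> w' <> 0 ->
    Cmod (D w 0 - D w' 0) <= 32 * (B * Cmod (w - w') + Cmod (q w - q w'))).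
  { intros w w' Hw Hw' Nw Nw'.
    assert (L : forall v : C, v <> 0 -> Clim (nearC' 0) (D v) (D v 0)).
    { intros v Nv. apply filter_le_Clim with (nearC 0).
      { intros P HP. unfold nearC', within. generalize HP. now apply filter_imp. }
      unfold D. apply Clim_mult; [typeclasses eauto|apply Clim_plus; clim|].
      apply Clim_inv; [typeclasses eauto| |apply Clim_plus; clim].
      now apply Cminus_eq_contra, not_eq_sym. }
    apply (Clim_Cmod_le (nearC' 0) (fun z => D w z + - (1) * D w' z)%C).
    - typeclasses eauto.
    - replace (D w 0 - D w' 0)%C with (D w 0 + - (1) * D w' 0)%C by ring.
      apply Clim_plus; [typeclasses eauto|now apply L|].
      apply Clim_mult; [typeclasses eauto|apply Clim_const; typeclasses eauto|now apply L].
    - unfold nearC', within.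
      assert (H1 : Cmod 0 < 1) by (rewrite Cmod_0; lra).
      generalize (filter_and _ _ (nearC_Cmod_lt 0 1 H1) (filter_and _ _
        (nearC_neq 0 w (not_eq_sym Nw)) (nearC_neq 0 w' (not_eq_sym Nw')))).
      apply filter_imp. intros z [Z1 [Z2 Z3]] Z0.
      replace (D w z + - (1) * D w' z)%C with (D w z - D w' z)%C by ring.
      now apply Key. }
  destruct (Clim_cauchy (nearC' 0) (fun w => D w 0)) as [l Hl].
  { intros eps Heps.
    (* Two points within e of 0 differ by at most 2 e, as do their values up to the same bound; 32
       (2 B e + 2 e) = eps / 2. *)
    set (e := eps / (128 * (B + 1))).
    assert (He : 0 < e) by (apply Rdiv_lt_0_compat; lra).
    exists (fun w => (Cmod w < Rmin e (/ 4) /\ Cmod (q w - q 0) < e) /\ w <> 0). split.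
    - unfold nearC', within.
      assert (H1 : Cmod 0 < Rmin e (/ 4)) by (rewrite Cmod_0; apply Rmin_pos; lra).
      generalize (filter_and _ _ (nearC_Cmod_lt 0 _ H1) (Hc e He)).
      apply filter_imp. intros y Hy Ny. split; assumption.
    - intros w w' [[W1 W2] W3] [[V1 V2] V3].
      pose proof (Rmin_l e (/ 4)); pose proof (Rmin_r e (/ 4)).
      eapply Rle_lt_trans; [apply Key0; try assumption; lra|].
      pose proof (Cmod_minus_le w w').
      pose proof (Cmod_minus_le (q w - q 0) (q w' - q 0)) as T.
      replace (q w - q 0 - (q w' - q 0))%C with (q w - q w')%C in T by ring.
      pose proof (Cmod_ge_0 (w - w')).
      assert (B * Cmod (w - w') <= B * (2 * e)) by (apply Rmult_le_compat_l; lra).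
      assert (E : 128 * (B + 1) * e = eps) by (unfold e; field; lra).
      nra. }
  exists (fun w => if Ceq_dec w 0 then l else D w 0). split.
  - intros y. destruct (Ceq_dec y 0) as [->|E]; [ring|].
    unfold D. field. exact E.
  - unfold ccont. destruct (Ceq_dec 0 0) as [_|]; [|contradiction].
    intros eps Heps. generalize (Hl eps Heps). unfold nearC', within. apply filter_imp.
    intros y Hy. destruct (Ceq_dec y 0) as [E|E]; [|now apply Hy].
    rewrite Cminus_diag, Cmod_0; exact Heps.
Qed.

(** The substitution y = z0 + r z reduces to the centre; continuity at z0 provides the bound on the
    small disc. *)
Lemma continuous_singularity (q : C -> C) (z0 : C) :
  nearC z0 (fun y => y <> z0 -> cdiff q y) -> ccont q z0 -> cdiff q z0.
Proof.
  intros Hd Hc.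
  destruct (proj1 (nearC_iff _ _) (filter_and _ _ Hd (Clim_bounded _ _ _ Hc))) as [r [Hr H]].
  assert (Er : RtoC r <> 0) by (intros E; apply RtoC_inj in E; lra).
  assert (Hin : forall z, Cmod z < 1 -> Cmod (z0 + r * z - z0) < r).
  { intros z Hz. replace (z0 + r * z - z0)%C with (r * z)%C by ring.
    rewrite Cmod_mult, Cmod_R, Rabs_pos_eq by lra. nra. }
  assert (Haff : forall z, cdiff (fun y => z0 + r * y)%C z).
  { intros z. apply cdiff_plus; [apply cdiff_const|apply cdiff_mult; [apply cdiff_const|apply cdiff_id]]. }
  assert (E0 : (z0 + r * 0)%C = z0) by ring.
  assert (G : cdiff (fun y => q (z0 + r * y)%C) 0).
  { apply continuous_singularity_0 with (Cmod (q z0) + 1).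
    - intros z Hz Nz. apply (cdiff_comp (fun y => z0 + r * y)%C q); [apply Haff|].
      apply (H _ (Hin z Hz)). intros E.
      apply (Cmult_neq_0 _ _ Er Nz). replace (r * z)%C with (z0 + r * z - z0)%C by ring.
      rewrite E. ring.
    - unfold ccont. apply (Clim_comp (nearC 0) (fun y => z0 + r * y)%C q (z0 + r * 0)%C).
      + exact (cdiff_cont _ _ (Haff 0)).
      + now rewrite E0.
    - intros z Hz. left. apply (H _ (Hin z Hz)). }
  apply cdiff_ext with (fun y => q (z0 + r * ((y - z0) / r))%C).
  { apply filter_forall. intros y.
    replace (z0 + r * ((y - z0) / r))%C with y by (field; exact Er). reflexivity. }
  apply (cdiff_comp (fun y => (y - z0) / r)%C (fun y => q (z0 + r * y)%C)).
  - apply cdiff_mult; [apply cdiff_minus; [apply cdiff_id|apply cdiff_const]|apply cdiff_const].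
  - replace ((z0 - z0) / r)%C with (RtoC 0) by (unfold Cdiv; ring). exact G.
Qed.

(** The quotient is continuous at z0 and differentiable nearby, so its singularity is removable.
    This divisibility by y - z0 takes the place of power series. *)
Lemma difference_quotient_cdiff (f : C -> C) (z0 : C) :
  nearC z0 (cdiff f) ->
  exists q, (forall y, f y = f z0 + (y - z0) * q y)%C /\ cdiff q z0 /\
    forall y, y <> z0 -> cdiff f y -> cdiff q y.
Proof.
  intros Hf. destruct (nearC_singleton _ _ Hf) as [q [Q1 Q2]].
  assert (Hq : forall y, y <> z0 -> cdiff f y -> cdiff q y).
  { intros y Ny Hy. apply cdiff_ext with (fun x => (f x - f z0) / (x - z0))%C.
    - generalize (nearC_neq y z0 Ny). apply filter_imp. intros x Nx. rewrite (Q1 x).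
      field. now apply Cminus_eq_contra.
    - apply cdiff_div; [now apply Cminus_eq_contra| |];
        apply cdiff_minus; try apply cdiff_const; [exact Hy|apply cdiff_id]. }
  exists q. split; [exact Q1|]. split; [|exact Hq].
  apply continuous_singularity; [|exact Q2].
  generalize Hf. apply filter_imp. intros y Hy Ny. now apply Hq.
Qed.

(** Multiplication by y - z0 makes f continuous with value 0 at z0, hence differentiable there;
    dividing the factor out again yields the extension. *)
Lemma bounded_singularity (f : C -> C) (z0 : C) (B : R) :
  nearC z0 (fun y => y <> z0 -> cdiff f y) ->
  nearC z0 (fun y => Cmod (f y) <= B) ->
  exists L, cdiff (fun y => if Ceq_dec y z0 then L else f y) z0.
Proof.
  intros Hd HB.
  assert (HB0 : 0 <= B) by (eapply Rle_trans; [apply Cmod_ge_0|apply (nearC_singleton _ _ HB)]).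
  assert (Hg : forall y, y <> z0 -> cdiff f y -> cdiff (fun y => (y - z0) * f y)%C y).
  { intros y Ny Hy. apply cdiff_mult; [apply cdiff_minus; [apply cdiff_id|apply cdiff_const]|exact Hy]. }
  assert (Gd : nearC z0 (cdiff (fun y => (y - z0) * f y)%C)).
  { assert (G0 : cdiff (fun y => (y - z0) * f y)%C z0).
    { apply continuous_singularity.
      - generalize Hd. apply filter_imp. intros y Hy Ny. now apply Hg, Hy.
      - unfold ccont. rewrite Cminus_diag, Cmult_0_l.
        intros eps Heps.
        assert (He : 0 < eps / (B + 1)) by (apply Rdiv_lt_0_compat; lra).
        generalize (filter_and _ _ HB (ccont_id z0 _ He)). apply filter_imp. intros y [Y1 Y2].
        replace ((y - z0) * f y - 0)%C with ((y - z0) * f y)%C by ring.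
        rewrite Cmod_mult. apply Rlt_div_r in Y2; [|lra].
        pose proof (Cmod_ge_0 (y - z0)). nra. }
    generalize Hd. apply filter_imp. intros y Hy.
    destruct (Ceq_dec y z0) as [->|Ny]; [exact G0|now apply Hg, Hy]. }
  destruct (difference_quotient_cdiff _ z0 Gd) as [q [Q1 [Q2 _]]].
  exists (q z0). apply cdiff_ext with q; [|exact Q2].
  apply filter_forall. intros y. destruct (Ceq_dec y z0) as [->|Ny]; [reflexivity|].
  specialize (Q1 y). rewrite Cminus_diag, Cmult_0_l, Cplus_0_l in Q1.
  assert (N := Cminus_eq_contra _ _ Ny).
  replace (q y) with ((y - z0) * q y / (y - z0))%C by (field; exact N).
  rewrite <- Q1. field. exact N.
Qed.

(** * Zeros of analytic functions *)

Lemma analytic_near (f : C -> C) (z : C) : analytic f -> Cmod z < 1 -> nearC z (cdiff f).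
Proof.
  intros Hf Hz. generalize (nearC_Cmod_lt z 1 Hz). apply filter_imp. exact Hf.
Qed.

Lemma analytic_divide_0 (f : C -> C) : analytic f ->
  exists u, analytic u /\ forall z, (f z = f 0 + z * u z)%C.
Proof.
  intros Hf.
  assert (H0 : Cmod 0 < 1) by (rewrite Cmod_0; lra).
  destruct (difference_quotient_cdiff f 0 (analytic_near f 0 Hf H0)) as [q [Q1 [Q2 Q3]]].
  exists q. split.
  - intros z Hz. destruct (Ceq_dec z 0) as [->|N]; [exact Q2|]. apply Q3; auto.
  - intros z. rewrite (Q1 z) at 1. f_equal. f_equal. ring.
Qed.

(** Turns local bounds into a uniform one. The predicate is abstract because it is used for values
    of functions as well as for the position of preimages under an automorphism. *)
Lemma compact_bound (P : R -> C -> Prop) (r : R) :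
  (forall B B' z, B <= B' -> P B z -> P B' z) ->
  (forall z, Cmod z <= r -> exists B, nearC z (fun y => Cmod y <= r -> P B y)) ->
  exists B, forall z, Cmod z <= r -> P B z.
Proof.
  intros Hmon Hloc.
  (* A single gauge encodes both the radius and the bound / d, so a positive lower bound for the
     gauge is a uniform bound. The factor 2 passes from coordinates to the modulus. *)
  assert (Hd : forall z : C, exists d : posreal, forall y,
    Cmod (y - z) < 2 * d -> Cmod y <= r -> P (/ d) y).
  { intros z. destruct (Rle_lt_dec (Cmod z) r) as [Hz|Hz].
    - destruct (Hloc z Hz) as [B HB].
      destruct (proj1 (nearC_iff _ _) HB) as [d [Hd H]].
      set (e := Rmin (d / 2) (/ (Rmax B 1))).
      assert (HB1 : 0 < Rmax B 1) by (pose proof (Rmax_r B 1); lra).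
      assert (He : 0 < e).
      { apply Rmin_pos; [lra|]. apply Rinv_0_lt_compat; exact HB1. }
      exists (mkposreal e He). simpl. intros y Hy Hyr.
      pose proof (Rmin_l (d / 2) (/ (Rmax B 1))). fold e in H0.
      pose proof (Rmin_r (d / 2) (/ (Rmax B 1))). fold e in H1.
      apply Hmon with B; [|apply H; lra].
      apply Rle_trans with (Rmax B 1); [apply Rmax_l|].
      apply Rinv_le_contravar in H1; [|exact He]. rewrite Rinv_inv in H1. exact H1.
    (* The compactness theorem covers a square; at points outside the disc the gauge is so small
       that the condition is vacuous. *)
    - assert (He : 0 < (Cmod z - r) / 2) by lra.
      exists (mkposreal _ He). simpl. intros y Hy Hyr.
      pose proof (Cmod_triangle_minus z y). rewrite Cmod_minus_sym in Hy. lra. }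
  pose (delta := fun z => proj1_sig (constructive_indefinite_description _ (Hd z))).
  assert (Hdelta : forall z y, Cmod (y - z) < 2 * delta z -> Cmod y <= r -> P (/ delta z) y).
  { intros z. apply (proj2_sig (constructive_indefinite_description _ (Hd z))). }
  destruct (compactness_value_2d (- r) r (- r) r (fun u v => delta (u, v))) as [d HD].
  exists (/ d). intros z Hz. apply NNPP. intros Hn.
  apply (HD (fst z) (snd z)).
  - pose proof (re_le_Cmod z). apply Rabs_le_between. unfold Re in *; lra.
  - pose proof (im_le_Cmod z). apply Rabs_le_between. unfold Im in *; lra.
  - intros (u & v & _ & _ & H1 & H2 & H3). apply Hn.
    apply Hmon with (/ delta (u, v)).
    + apply Rinv_le_contravar; [apply cond_pos|exact H3].
    + apply Hdelta; [|exact Hz].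
      eapply Rle_lt_trans; [apply Cmod_le_Rmax|].
      apply Rmult_lt_compat_l; [lra|]. apply Rmax_lub_lt; simpl; assumption.
Qed.

Lemma analytic_bounded (f : C -> C) (r : R) : analytic f -> r < 1 ->
  exists B, forall z, Cmod z <= r -> Cmod (f z) <= B.
Proof.
  intros Hf Hr. apply (compact_bound (fun B z => Cmod (f z) <= B)).
  - intros B B' z; lra.
  - intros z Hz. exists (Cmod (f z) + 1).
    assert (Hz1 : Cmod z < 1) by lra.
    generalize (Clim_bounded _ _ _ (cdiff_cont f z (Hf z Hz1))).
    apply filter_imp. intros y Hy _; lra.
Qed.

(** If |f| <= B on a disc larger than |z| <= r, the maximum principle gives |u| <= B / r^k, hence |f
    w| <= B (|w| / r)^k for every k, and this tends to 0 for |w| < r. *)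
Lemma analytic_flat_0 (f : C -> C) : analytic f ->
  (forall k, exists u, analytic u /\ forall z, (f z = z ^ k * u z)%C) ->
  forall z, Cmod z < 1 -> f z = 0.
Proof.
  intros Hf Hk w Hw. apply NNPP. intros N.
  pose proof (Cmod_ge_0 w) as W0.
  assert (Nw : w <> 0).
  { intros ->. destruct (Hk 1%nat) as [u [_ Hu]]. apply N. rewrite Hu. simpl. ring. }
  apply Cmod_gt_0 in Nw. apply Cmod_gt_0 in N.
  set (r := (2 * Cmod w + 1) / 3). set (r' := (Cmod w + 2) / 3).
  assert (Hr : Cmod w < r /\ r < r' /\ r' < 1) by (unfold r, r'; lra).
  destruct (analytic_bounded f r' Hf ltac:(lra)) as [B HB].
  apply (pow_unbounded_contra (Cmod (f w)) B (r / Cmod w)); [exact N| |].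
  { apply Rlt_div_r; lra. }
  intros k. destruct (Hk k) as [u [Hu1 Hu2]].
  assert (Hur : Cmod (u w) <= B / r ^ k).
  (* Rescaling by r' makes the annulus r < |z| < r' one at the boundary of the unit disc. *)
  { set (s := RtoC r').
    assert (Es : s <> 0) by (intros E; apply RtoC_inj in E; lra).
    assert (Ms : Cmod s = r') by (unfold s; rewrite Cmod_R, Rabs_pos_eq; lra).
    assert (Hs : Cmod (w / s) < 1) by (rewrite Cmod_div, Ms by exact Es; apply Rlt_div_l; lra).
    replace (u w) with (u (s * (w / s))%C) by (f_equal; field; exact Es).
    apply (max_principle (fun z => u (s * z)%C) (B / r ^ k) (r / r')); [| | |exact Hs].
    - intros z Hz. apply (cdiff_comp (fun z => s * z)%C u).
      + apply cdiff_mult; [apply cdiff_const|apply cdiff_id].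
      + apply Hu1. rewrite Cmod_mult, Ms. nra.
    - apply Rlt_div_l; lra.
    - intros z [Hz1 Hz2]. apply Rlt_div_l in Hz1; [|lra].
      assert (M : Cmod (s * z) = r' * Cmod z) by (rewrite Cmod_mult, Ms; reflexivity).
      assert (Hrk : r ^ k <= Cmod (s * z) ^ k) by (apply pow_incr; lra).
      assert (Hrp : 0 < r ^ k) by (apply pow_lt; lra).
      pose proof (HB (s * z)%C ltac:(nra)) as A.
      rewrite Hu2, Cmod_mult, Cmod_pow in A.
      apply Rle_div_r; [exact Hrp|].
      pose proof (Cmod_ge_0 (u (s * z)%C)). nra. }
  rewrite Hu2, Cmod_mult, Cmod_pow.
  unfold Rdiv. rewrite Rpow_mult_distr, pow_inv.
  replace (Cmod w ^ k * Cmod (u w) * (r ^ k * / Cmod w ^ k)) with (Cmod (u w) * r ^ k)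
    by (field; apply pow_nonzero; lra).
  apply Rle_div_r in Hur; [exact Hur|]. apply pow_lt; lra.
Qed.

(** If repeated division by z never met a factor with u 0 <> 0, every power of z would divide f, and
    f would vanish. *)
Lemma analytic_order_0 (f : C -> C) : analytic f ->
  (exists z, Cmod z < 1 /\ f z <> 0) ->
  exists k u, analytic u /\ u 0 <> 0 /\ forall z, (f z = z ^ k * u z)%C.
Proof.
  intros Hf [z [Hz Nz]]. apply NNPP. intros Hno. apply Nz.
  apply analytic_flat_0; [exact Hf| |exact Hz].
  intros k. induction k as [|k [u [U1 U2]]].
  - exists f. split; [exact Hf|]. intros y; simpl; ring.
  - destruct (Ceq_dec (u 0) 0) as [E|E].
    + destruct (analytic_divide_0 u U1) as [v [V1 V2]].
      exists v. split; [exact V1|]. intros y. rewrite U2, V2, E. simpl. ring.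
    + exfalso. apply Hno. exists k, u. auto.
Qed.

(** [mob a] moves a to the centre, where f becomes z^k u with u nonzero near 0. *)
Lemma analytic_isolated_zeros (f : C -> C) : analytic f ->
  (exists z, Cmod z < 1 /\ f z <> 0) ->
  forall a, Cmod a < 1 -> nearC a (fun y => y <> a -> f y <> 0).
Proof.
  intros Hf [z [Hz Nz]] a Ha.
  destruct (analytic_order_0 (fun z => f (mob a z))) as [k [u [U1 [U2 U3]]]].
  - now apply analytic_mob.
  - exists (mob (- a) z). split; [apply mob_disc; [now rewrite Cmod_opp|exact Hz]|].
    rewrite mob_inv' by lra. exact Nz.
  - assert (Hma : Cmod (- a) < 1) by now rewrite Cmod_opp.
    assert (C1 : ccont (mob (- a)) a) by (apply cdiff_cont, cdiff_mob; lra).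
    assert (E : mob (- a) a = 0).
    { unfold mob. replace (a + - a)%C with (RtoC 0) by ring. unfold Cdiv; ring. }
    assert (L : Clim (nearC a) (fun y => u (mob (- a) y)) (u 0)).
    { rewrite <- E. apply Clim_comp; [typeclasses eauto|exact C1|].
      rewrite E. apply cdiff_cont, U1. rewrite Cmod_0; lra. }
    generalize (filter_and _ _ (nearC_Cmod_lt a 1 Ha) (Clim_neq_0 _ _ _ U2 L)).
    apply filter_imp. intros y [Y1 Y2] Ny.
    rewrite <- (mob_inv' a y Ha ltac:(lra)), U3.
    apply Cmult_neq_0.
    + apply Cpow_nz. intros E'. apply Ny.
      rewrite <- (mob_inv' a y Ha ltac:(lra)), E', mob_0. reflexivity.
    + apply Cmod_gt_0. pose proof (Cmod_ge_0 (u 0)). lra.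
Qed.

(** * Schwarz's lemma and the strong maximum principle *)

Lemma schwarz_quotient (f u : C -> C) : analytic u ->
  (forall z, f z = z * u z)%C ->
  (forall z, Cmod z < 1 -> Cmod (f z) <= 1) ->
  forall z, Cmod z < 1 -> Cmod (u z) <= 1.
Proof.
  intros U1 U2 F1 w Hw.
  assert (Hu : forall r, 0 < r < 1 -> Cmod (u w) <= / r).
  { intros r Hr. apply (max_principle u (/ r) r); [exact U1|lra| |exact Hw].
    intros z Hz. pose proof (F1 z ltac:(lra)) as A.
    rewrite U2, Cmod_mult in A.
    apply Rmult_le_reg_l with r; [lra|]. rewrite Rinv_r by lra.
    pose proof (Cmod_ge_0 (u z)). nra. }
  apply Rnot_lt_le. intros Hlt.
  (* The limit r -> 1 is replaced by the one radius for which 1 / r is the midpoint of 1 and |u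
     w|. *)
  assert (Hr : 0 < / ((Cmod (u w) + 1) / 2) < 1).
  { split; [apply Rinv_0_lt_compat; lra|]. rewrite <- Rinv_1 at 2.
    apply Rinv_lt_contravar; lra. }
  pose proof (Hu _ Hr) as A. rewrite Rinv_inv in A. lra.
Qed.

Lemma schwarz (f : C -> C) : analytic f -> f 0 = 0 ->
  (forall z, Cmod z < 1 -> Cmod (f z) <= 1) ->
  forall z, Cmod z < 1 -> Cmod (f z) <= Cmod z.
Proof.
  intros Hf F0 F1 w Hw.
  destruct (analytic_divide_0 f Hf) as [u [U1 U2]].
  assert (U3 : forall z, (f z = z * u z)%C) by (intros z; rewrite U2, F0; ring).
  pose proof (schwarz_quotient f u U1 U3 F1 w Hw).
  rewrite U3, Cmod_mult. pose proof (Cmod_ge_0 w). nra.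
Qed.

Lemma schwarz_quotient_pow (f u : C -> C) (k : nat) : analytic u ->
  (forall z, f z = z ^ k * u z)%C ->
  (forall z, Cmod z < 1 -> Cmod (f z) <= 1) ->
  forall z, Cmod z < 1 -> Cmod (u z) <= 1.
Proof.
  intros Hu. revert f. induction k as [|k IH]; intros f Hf F1.
  - intros z Hz. replace (u z) with (f z) by (rewrite Hf; simpl; ring). now apply F1.
  - apply (IH (fun z => z ^ k * u z)%C); [reflexivity|].
    apply (schwarz_quotient f); [| |exact F1].
    + intros z Hz. apply cdiff_mult; [apply cdiff_pow, cdiff_id|now apply Hu].
    + intros z. rewrite Hf. simpl. ring.
Qed.

(* Schwarz-Pick for t f, with t tending to 1. *)
Lemma strong_max_principle (f : C -> C) : analytic f -> Cmod (f 0) = 1 ->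
  (forall z, Cmod z < 1 -> Cmod (f z) <= 1) ->
  forall z, Cmod z < 1 -> f z = f 0.
Proof.
  intros Hf F0 F1 w Hw.
  assert (N0 : f 0 <> 0) by (apply Cmod_gt_0; lra).
  set (g := fun z => (f z / f 0)%C).
  assert (G1 : forall z, Cmod z < 1 -> Cmod (g z) <= 1).
  { intros z Hz. unfold g. rewrite Cmod_div, F0 by exact N0. pose proof (F1 z Hz); lra. }
  assert (Gd : analytic g).
  { intros z Hz. apply cdiff_mult; [now apply Hf|apply cdiff_const]. }
  assert (G0 : g 0 = 1) by (unfold g; field; exact N0).
  (* As t g 0 = t, the map [mob (- t)] sends the value at the centre to 0 and Schwarz's lemma
     applies; t < 1 keeps the parameter of the Moebius map inside the disc. *)
  assert (Key : forall t, 0 < t < 1 -> Cmod (t * g w - t) <= Cmod w * Cmod (1 - t * (t * g w))).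
  { intros t Ht.
    assert (Mt : Cmod (- RtoC t) < 1) by (rewrite Cmod_opp, Cmod_R, Rabs_pos_eq; lra).
    assert (Hs : Cmod (mob (- RtoC t) (t * g w)) <= Cmod w).
    { assert (Ht2 : forall z, Cmod z < 1 -> Cmod (t * g z) < 1).
      { intros z Hz. rewrite Cmod_mult, Cmod_R, Rabs_pos_eq by lra.
        pose proof (G1 z Hz); pose proof (Cmod_ge_0 (g z)); nra. }
      apply (schwarz (fun z => mob (- RtoC t) (t * g z))).
      - intros z Hz. apply (cdiff_comp (fun z => t * g z)%C (mob (- RtoC t))).
        + apply cdiff_mult; [apply cdiff_const|now apply Gd].
        + apply cdiff_mob; [exact Mt|left; now apply Ht2].
      - rewrite G0. unfold mob. replace (t * 1 + - t)%C with (RtoC 0) by ring. unfold Cdiv; ring.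
      - intros z Hz. left. apply mob_disc; [exact Mt|now apply Ht2].
      - exact Hw. }
    unfold mob in Hs.
    assert (Ec : Cconj (- RtoC t) = (- RtoC t)%C).
    { unfold Cconj, RtoC, Copp; simpl. f_equal; ring. }
    rewrite Ec in Hs.
    assert (Ed : (1 + - RtoC t * (t * g w))%C = (1 - t * (t * g w))%C) by ring.
    rewrite Ed in Hs.
    assert (Nd : (1 - t * (t * g w))%C <> 0).
    { rewrite <- Ed. apply one_plus_neq_0.
      rewrite !Cmod_mult, Cmod_opp, Cmod_R, Rabs_pos_eq by lra.
      pose proof (G1 w Hw); pose proof (Cmod_ge_0 (g w)). nra. }
    rewrite Cmod_div in Hs by exact Nd.
    apply Rle_div_l in Hs; [exact Hs|]. now apply Cmod_gt_0. }
  assert (E : g w = 1).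
  { apply Ceq_minus, Cmod_eq_0. apply NNPP. intros Ne.
    assert (P : 0 < Cmod (g w - 1)) by (pose proof (Cmod_ge_0 (g w - 1)); destruct H; congruence).
    set (d := Cmod (g w - 1)) in *.
    pose proof (Cmod_ge_0 w).
    (* As t tends to 1 this becomes d <= |w| d, impossible for d > 0; the e below is how close to 1
       is needed. *)
    assert (K : forall t, 0 < t < 1 -> t * d <= Cmod w * (d + 2 * (1 - t))).
    { intros t Ht. specialize (Key t Ht).
      replace (t * g w - t)%C with (t * (g w - 1))%C in Key by ring.
      rewrite Cmod_mult, Cmod_R, Rabs_pos_eq in Key by lra. fold d in Key.
      eapply Rle_trans; [exact Key|]. apply Rmult_le_compat_l; [lra|].
      replace (1 - t * (t * g w))%C with ((1 - g w) + RtoC (1 - t * t) * g w)%C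
        by (rewrite RtoC_minus, RtoC_mult; ring).
      eapply Rle_trans; [apply Cmod_triangle|].
      rewrite Cmod_minus_sym, Cmod_mult, Cmod_R, Rabs_pos_eq by nra. fold d.
      pose proof (G1 w Hw); pose proof (Cmod_ge_0 (g w)).
      assert (0 <= 1 - t * t <= 2 * (1 - t)) by nra. nra. }
    set (m := (1 - Cmod w) * d).
    assert (Hm : 0 < m) by (unfold m; nra).
    assert (Hd2 : 0 < d + 2) by lra.
    set (e := Rmin (/ 2) (m / (2 * (d + 2)))).
    assert (He : 0 < e) by (apply Rmin_pos; [lra|apply Rdiv_lt_0_compat; lra]).
    pose proof (Rmin_l (/ 2) (m / (2 * (d + 2)))) as E1. fold e in E1.
    pose proof (Rmin_r (/ 2) (m / (2 * (d + 2)))) as E2. fold e in E2.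
    apply Rle_div_r in E2; [|lra].
    specialize (K (1 - e) ltac:(lra)). unfold m in *. nra. }
  unfold g in E. replace (f w) with (f w / f 0 * f 0)%C by (field; exact N0).
  rewrite E. ring.
Qed.

(** * Automorphisms of the disc *)

(* If w is omitted near 0 while close to f 0, then 1 / (f - w) is larger at 0 than
   on a surrounding annulus. *)
Lemma analytic_open_at_0 (f : C -> C) : analytic f ->
  (exists z, Cmod z < 1 /\ f z <> f 0) ->
  nearC (f 0) (fun w => exists z, Cmod z < / 2 /\ f z = w).
Proof.
  intros Hf [z1 [Hz1 Nz1]].
  destruct (analytic_order_0 (fun z => f z - f 0)%C) as [k [u [U1 [U2 U3]]]].
  { intros z Hz. apply cdiff_minus; [now apply Hf|apply cdiff_const]. }
  { exists z1. split; [exact Hz1|now apply Cminus_eq_contra]. }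
  assert (H0 : Cmod 0 < 1) by (rewrite Cmod_0; lra).
  pose proof (Clim_neq_0 _ _ _ U2 (cdiff_cont u 0 (U1 0 H0))) as HN.
  destruct (proj1 (nearC_iff _ _) HN) as [d [Hd HD]].
  apply Cmod_gt_0 in U2.
  set (rho := Rmin d (/ 2)).
  assert (Hrho : 0 < rho) by (apply Rmin_pos; lra).
  pose proof (Rmin_l d (/ 2)) as L1. pose proof (Rmin_r d (/ 2)) as L2. fold rho in L1, L2.
  (* A lower bound for |f - f 0| on rho / 2 <= |z| < rho, from f - f 0 = z^k u and |u| > |u 0| / 2
     there. *)
  set (m := (rho / 2) ^ k * (Cmod (u 0) / 2)).
  assert (Hm : 0 < m) by (apply Rmult_lt_0_compat; [apply pow_lt; lra|lra]).
  assert (Hlow : forall z, rho / 2 <= Cmod z < rho -> m <= Cmod (f z - f 0)).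
  { intros z Hz. rewrite U3, Cmod_mult, Cmod_pow.
    apply Rmult_le_compat; [apply pow_le; lra|lra|apply pow_incr; lra|].
    left. apply HD. replace (z - 0)%C with z by ring. lra. }
  (* On the annulus |f - w| is then at least 2 m / 3, at the centre less than m / 3. *)
  apply nearC_iff. exists (m / 3). split; [lra|].
  intros w Hw. apply NNPP. intros Hno.
  assert (Nw : forall z, Cmod z < rho -> (f z - w)%C <> 0).
  { intros z Hz E. apply Hno. exists z. split; [lra|now apply Ceq_minus]. }
  assert (Er : Cmod rho = rho) by (rewrite Cmod_R, Rabs_pos_eq; lra).
  assert (Hb : Cmod (/ (f (rho * 0)%C - w)) <= / (2 * m / 3)).
  { refine (max_principle (fun z => / (f (rho * z) - w))%C _ (/ 2) _ _ _ 0 H0); [|lra|].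
    - intros z Hz.
      assert (Hrz : Cmod (rho * z) < rho) by (rewrite Cmod_mult, Er; nra).
      apply cdiff_inv; [now apply Nw|]. apply cdiff_minus; [|apply cdiff_const].
      apply (cdiff_comp (fun z => rho * z)%C f).
      + apply cdiff_mult; [apply cdiff_const|apply cdiff_id].
      + apply Hf. lra.
    - intros z Hz.
      assert (Hrz : rho / 2 <= Cmod (rho * z) < rho) by (rewrite Cmod_mult, Er; nra).
      rewrite Cmod_inv by (apply Nw; lra).
      apply Rinv_le_contravar; [lra|].
      pose proof (Hlow _ Hrz). pose proof (Cmod_triangle_minus (f (rho * z)%C - f 0) (f (rho * z)%C - w)) as T.
      replace (f (rho * z)%C - f 0 - (f (rho * z)%C - w))%C with (w - f 0)%C in T by ring. lra. }
  rewrite Cmult_0_r in Hb.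
  assert (N0 : (f 0 - w)%C <> 0) by (apply Nw; rewrite Cmod_0; exact Hrho).
  rewrite Cmod_inv in Hb by exact N0.
  apply Rinv_le_contravar in Hb; [|apply Rinv_0_lt_compat; now apply Cmod_gt_0].
  rewrite !Rinv_inv, Cmod_minus_sym in Hb. lra.
Qed.

(** Let phi a = w. By openness all values near w are taken on the image of |z| < 1/2 under [mob a],
    and by injectivity nowhere else; that image stays away from the circle. Compactness of |w| <= R0
    makes the distance uniform. *)
Lemma disc_automorphism_proper (phi : C -> C) (R0 : R) :
  bijective_on open_disc phi -> analytic phi -> R0 < 1 ->
  exists r, r < 1 /\ forall z, r < Cmod z < 1 -> R0 < Cmod (phi z).
Proof.
  intros [Hmaps [Hinj Hsurj]] Hphi HR.
  destruct (compact_bound (fun B w => forall z, Cmod z < 1 -> phi z = w -> / (1 - Cmod z) <= B) R0)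
    as [B HB].
  - intros B B' w HBB H z Hz E. apply Rle_trans with B; [now apply H|exact HBB].
  - intros w Hw. assert (Hw1 : Cmod w < 1) by lra.
    destruct (Hsurj w Hw1) as [a [Ha Ea]]. unfold open_disc in Ha.
    assert (Hma : Cmod (- a) < 1) by now rewrite Cmod_opp.
    assert (Ho : nearC (phi (mob a 0)) (fun w => exists z, Cmod z < / 2 /\ phi (mob a z) = w)).
    { apply (analytic_open_at_0 (fun z => phi (mob a z))).
      - now apply analytic_mob.
      - assert (Hh : Cmod (/ 2)%C < 1).
        { rewrite Cmod_inv, Cmod_R, Rabs_pos_eq by (try lra; intros E; apply RtoC_inj in E; lra). lra. }
        exists (/ 2)%C. split; [exact Hh|]. intros E.
        apply Hinj in E; try (apply mob_disc; try assumption; rewrite Cmod_0; lra).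
        apply (f_equal (mob (- a))) in E.
        rewrite !mob_inv in E by (try assumption; try rewrite Cmod_0; lra).
        apply (f_equal Cmod) in E. rewrite Cmod_0 in E.
        assert (Hne : (/ 2)%C <> 0).
        { intros E2. apply (f_equal (fun z => 2 * z)%C) in E2.
          rewrite Cinv_r in E2 by (intros E3; apply RtoC_inj in E3; lra).
          rewrite Cmult_0_r in E2. apply RtoC_inj in E2. lra. }
        apply Cmod_gt_0 in Hne. lra. }
    rewrite mob_0, Ea in Ho.
    destruct (mob_annulus (- a) (/ 2) Hma ltac:(lra)) as [r1 [Hr1 H1]].
    exists (/ (1 - r1)). generalize Ho. apply filter_imp.
    intros w' [z [Hz Ez]] _ z' Hz' Ez'.
    assert (E : z' = mob a z).
    { apply Hinj; [exact Hz'|apply mob_disc; lra|congruence]. }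
    apply Rinv_le_contravar; [lra|].
    assert (Cmod z' <= r1); [|lra].
    apply Rnot_lt_le. intros Hlt. specialize (H1 z' (conj Hlt Hz')).
    rewrite E, mob_inv in H1 by lra. lra.
  - exists (1 - / (Rmax B 1)).
    assert (HB1 : 0 < Rmax B 1) by (pose proof (Rmax_r B 1); lra).
    assert (HB2 : 0 < / Rmax B 1) by now apply Rinv_0_lt_compat.
    split; [lra|]. intros z Hz. apply Rnot_le_lt. intros Hle.
    specialize (HB (phi z) Hle z (proj2 Hz) eq_refl).
    pose proof (Rmax_l B 1).
    assert (A : / (1 - Cmod z) <= Rmax B 1) by lra.
    apply Rinv_le_contravar in A; [|apply Rinv_0_lt_compat; lra].
    rewrite Rinv_inv in A. lra.
Qed.

Lemma de_moivre (t : R) (n : nat) :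
  ((cos t, sin t) ^ n)%C = (cos (INR n * t), sin (INR n * t)).
Proof.
  induction n as [|n IH].
  - simpl. rewrite Rmult_0_l, cos_0, sin_0. reflexivity.
  - simpl Cpow. rewrite IH, S_INR, Rmult_plus_distr_r, Rmult_1_l, cos_plus, sin_plus.
    unfold Cmult; simpl. f_equal; ring.
Qed.

(** In f = z^k u the factor u has no zeros and |u| <= 1 by Schwarz. Properness makes |u| >= |f|
    close to 1 near the circle, so the maximum principle for 1 / u gives |u| >= 1. Hence u is
    constant, and injectivity forces k = 1. *)
Lemma disc_automorphism_fixing_0 (f : C -> C) :
  bijective_on open_disc f -> analytic f -> f 0 = 0 ->
  exists c, Cmod c = 1 /\ forall z, Cmod z < 1 -> (f z = c * z)%C.
Proof.
  intros Hb Hf F0. pose proof Hb as [Hmaps [Hinj Hsurj]].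
  assert (H0 : Cmod 0 < 1) by (rewrite Cmod_0; lra).
  assert (Hh : Cmod (RtoC (/ 2)) = / 2) by (rewrite Cmod_R, Rabs_pos_eq; lra).
  assert (Nh : RtoC (/ 2) <> 0) by (intros E; apply RtoC_inj in E; lra).
  assert (Nz : forall z, Cmod z < 1 -> z <> 0 -> f z <> 0).
  { intros z Hz Nz E. apply Nz, Hinj; [exact Hz|exact H0|congruence]. }
  destruct (analytic_order_0 f Hf) as [k [u [U1 [U2 U3]]]].
  { exists (RtoC (/ 2)). split; [lra|]. apply Nz; [lra|exact Nh]. }
  assert (Nu : forall z, Cmod z < 1 -> u z <> 0).
  { intros z Hz. destruct (Ceq_dec z 0) as [->|N]; [exact U2|].
    intros E. apply (Nz z Hz N). rewrite U3, E. ring. }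
  assert (Hup : forall z, Cmod z < 1 -> Cmod (u z) <= 1).
  { apply (schwarz_quotient_pow f u k U1 U3). intros z Hz. left. now apply Hmaps. }
  assert (Hlow : forall z, Cmod z < 1 -> 1 <= Cmod (u z)).
  { intros w Hw. apply Rnot_lt_le. intros Hlt.
    pose proof (proj1 (Cmod_gt_0 _) (Nu w Hw)) as Pw.
    set (R0 := (Cmod (u w) + 1) / 2).
    assert (HR : Cmod (u w) < R0 < 1) by (unfold R0; lra).
    destruct (disc_automorphism_proper f R0 Hb Hf (proj2 HR)) as [r [Hr H]].
    assert (A : Cmod (/ u w) <= / R0).
    { apply (max_principle (fun z => / u z)%C _ r); [|exact Hr| |exact Hw].
      - intros z Hz. apply cdiff_inv; [now apply Nu|now apply U1].
      - intros z Hz. rewrite Cmod_inv by (apply Nu; lra).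
        apply Rinv_le_contravar; [lra|].
        specialize (H z Hz). rewrite U3, Cmod_mult, Cmod_pow in H.
        assert (Cmod z ^ k <= 1) by (rewrite <- (pow1 k); apply pow_incr; split; [apply Cmod_ge_0|lra]).
        pose proof (Cmod_ge_0 (u z)). nra. }
    rewrite Cmod_inv in A by now apply Nu.
    apply Rinv_le_contravar in A; [|apply Rinv_0_lt_compat; lra].
    rewrite !Rinv_inv in A. lra. }
  assert (Hu0 : Cmod (u 0) = 1) by (apply Rle_antisym; auto).
  assert (Ef : forall z, Cmod z < 1 -> (f z = u 0 * z ^ k)%C).
  { intros z Hz. rewrite U3, (strong_max_principle u U1 Hu0 Hup z Hz). ring. }
  exists (u 0). split; [exact Hu0|]. intros z Hz. rewrite (Ef z Hz).
  destruct k as [|[|k]].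
  - exfalso. rewrite (Ef 0 H0) in F0. simpl in F0. rewrite Cmult_1_r in F0. exact (U2 F0).
  - simpl. ring.
  (* For exponent n >= 2 the points 1/2 and 1/2 times an n-th root of unity other than 1 have the
     same image. *)
  - exfalso. assert (HPI := PI_RGT_0).
    set (n := S (S k)). assert (Hn : 2 <= INR n).
    { unfold n. rewrite !S_INR. pose proof (pos_INR k). lra. }
    set (t := 2 * PI / INR n).
    assert (Ht : 0 < t <= PI).
    { unfold t. split; [apply Rdiv_lt_0_compat; lra|]. apply Rle_div_l; nra. }
    assert (Et : INR n * t = 2 * PI) by (unfold t; field; lra).
    assert (Hw : ((cos t, sin t) ^ n)%C = 1) by (rewrite de_moivre, Et, cos_2PI, sin_2PI; reflexivity).
    assert (Mw : Cmod (cos t, sin t) = 1).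
    { unfold Cmod; simpl. rewrite !Rmult_1_r. change (sqrt (Rsqr (cos t) + Rsqr (sin t)) = 1).
      rewrite Rplus_comm, sin2_cos2. apply sqrt_1. }
    assert (E : (RtoC (/ 2) * (cos t, sin t))%C = RtoC (/ 2)).
    { apply Hinj; unfold open_disc; rewrite ?Cmod_mult, ?Mw; try lra.
      rewrite !Ef by (rewrite ?Cmod_mult, ?Mw; lra). fold n.
      rewrite Cpow_mult_l, Hw. ring. }
    set (w := (cos t, sin t) : C) in *.
    assert (E1 : w = RtoC 1).
    { replace w with (RtoC (/ 2) * w / RtoC (/ 2))%C by (field; exact Nh).
      rewrite E. field. exact Nh. }
    apply (f_equal fst) in E1. simpl in E1.
    pose proof (cos_decreasing_1 0 t). rewrite cos_0, E1 in H. lra.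
Qed.

Lemma disc_automorphism_mob (phi : C -> C) : disc_automorphism phi ->
  exists a c, Cmod a < 1 /\ Cmod c = 1 /\ forall z, Cmod z < 1 -> (phi z = c * mob a z)%C.
Proof.
  intros [Hb Ha].
  assert (Hphi : analytic phi) by (intros z Hz; now apply ex_derive_iff_cdiff, Ha).
  pose proof Hb as [Hmaps [Hinj Hsurj]].
  assert (H0 : open_disc 0) by (unfold open_disc; rewrite Cmod_0; lra).
  destruct (Hsurj _ H0) as [a [Da Ea]]. unfold open_disc in Da.
  assert (Hma : Cmod (- a) < 1) by now rewrite Cmod_opp.
  destruct (disc_automorphism_fixing_0 (fun z => phi (mob a z))) as [c [Hc1 Hc2]].
  - split; [|split].
    + intros z Hz. now apply Hmaps, mob_disc.
    + intros x y Hx Hy E. unfold open_disc in *.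
      apply Hinj in E; try (apply mob_disc; assumption).
      apply (f_equal (mob (- a))) in E. rewrite !mob_inv in E by lra. exact E.
    + intros y Hy. destruct (Hsurj y Hy) as [x [Hx Ex]]. unfold open_disc in *.
      exists (mob (- a) x). split; [now apply mob_disc|]. rewrite mob_inv' by lra. exact Ex.
  - now apply analytic_mob.
  - now rewrite mob_0.
  - exists (- a)%C, c. split; [exact Hma|]. split; [exact Hc1|].
    intros z Hz. rewrite <- Hc2 by now apply mob_disc. rewrite mob_inv' by lra. reflexivity.
Qed.

(** * The disc algebra and its characters *)

Definition nearD (x : closed_disc) : (closed_disc -> Prop) -> Prop :=
  @locally closed_disc_UniformSpace x.

Global Instance nearD_filter (x : closed_disc) : ProperFilter (nearD x).
Proof. apply (@locally_filter closed_disc_UniformSpace). Qed.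

(** Balls in C are those of the product R * R, so comparison with the modulus costs a factor 2. *)
Lemma ball_C_Cmod (u v : C) (eps : R) : @ball C_UniformSpace u eps v -> Cmod (v - u) < 2 * eps.
Proof.
  intros [H1 H2]. eapply Rle_lt_trans; [apply Cmod_le_Rmax|].
  apply Rmult_lt_compat_l; [lra|]. apply Rmax_lub_lt; [exact H1|exact H2].
Qed.

Lemma Cmod_ball_C (u v : C) (eps : R) : Cmod (v - u) < eps -> @ball C_UniformSpace u eps v.
Proof. apply (C_NormedModule_mixin_compat1 u v eps). Qed.

Lemma nearD_iff (x : closed_disc) (P : closed_disc -> Prop) :
  nearD x P <-> exists d, 0 < d /\ forall y, Cmod (cdval y - cdval x) < d -> P y.
Proof.
  split.
  - intros [d H]. exists d. split; [apply cond_pos|]. intros y Hy. apply H.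
    now apply Cmod_ball_C.
  - intros [d [Hd H]]. assert (Hd2 : 0 < d / 2) by lra. exists (mkposreal _ Hd2).
    intros y Hy. apply H. apply ball_C_Cmod in Hy. simpl in Hy. lra.
Qed.

Lemma continuous_iff_Clim (f : closed_disc -> C) (x : closed_disc) :
  continuous f x <-> Clim (nearD x) f (f x).
Proof.
  split.
  - intros H eps Heps. assert (He : 0 < eps / 2) by lra.
    generalize (proj1 (filterlim_locally _ _) H (mkposreal _ He)).
    apply filter_imp. intros y Hy. apply ball_C_Cmod in Hy. simpl in Hy. lra.
  - intros H. apply filterlim_locally. intros eps.
    generalize (H eps (cond_pos eps)). apply filter_imp. intros y Hy. now apply Cmod_ball_C.
Qed.

Lemma continuous_disc_iff_Clim (Phi : closed_disc -> closed_disc) (x : closed_disc) :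
  continuous Phi x <-> Clim (nearD x) (fun y => cdval (Phi y)) (cdval (Phi x)).
Proof.
  rewrite <- (continuous_iff_Clim (fun y => cdval (Phi y)) x). unfold continuous.
  split; intros H; apply filterlim_locally; intros eps;
    generalize (proj1 (filterlim_locally _ _) H eps); apply filter_imp; intros y Hy; exact Hy.
Qed.

Lemma Clim_cdval (x : closed_disc) : Clim (nearD x) cdval (cdval x).
Proof. intros eps Heps. apply nearD_iff. exists eps. auto. Qed.

(** Makes the lemmas on functions of a complex variable applicable; the value 0 outside the closed
    disc is a mere default. *)
Definition ext (f : closed_disc -> C) (z : C) : C :=
  match Rle_dec (Cmod z) 1 with
  | left H => f (exist _ z H)
  | right _ => RtoC 0
  end.

Lemma cdval_inj (x y : closed_disc) : cdval x = cdval y -> x = y.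
Proof.
  destruct x as [x Hx], y as [y Hy]; simpl. intros ->. f_equal. apply proof_irrelevance.
Qed.

Lemma ext_cdval (f : closed_disc -> C) (x : closed_disc) : ext f (cdval x) = f x.
Proof.
  unfold ext. destruct (Rle_dec (Cmod (cdval x)) 1) as [H|H].
  - f_equal. now apply cdval_inj.
  - contradiction (H (proj2_sig x)).
Qed.

Lemma disc_algebra_intro (f : closed_disc -> C) (F : C -> C) :
  (forall x, Clim (nearD x) f (f x)) -> (forall x, F (cdval x) = f x) -> analytic F ->
  disc_algebra f.
Proof.
  intros H1 H2 H3. split.
  - intros x. now apply continuous_iff_Clim.
  - exists F. split; [exact H2|]. intros z Hz. apply ex_derive_iff_cdiff, H3, Hz.
Qed.

Lemma disc_algebra_continuous (f : closed_disc -> C) (x : closed_disc) :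
  disc_algebra f -> Clim (nearD x) f (f x).
Proof. intros [H _]. now apply continuous_iff_Clim. Qed.

Lemma disc_algebra_analytic (f : closed_disc -> C) : disc_algebra f -> analytic (ext f).
Proof.
  intros [_ [F [H1 H2]]] z Hz. apply cdiff_ext with F.
  - generalize (nearC_Cmod_lt z 1 Hz). apply filter_imp. intros y Hy.
    change y with (cdval (exist _ y (Rlt_le _ _ Hy))). now rewrite ext_cdval, H1.
  - apply ex_derive_iff_cdiff, H2, Hz.
Qed.

Lemma disc_algebra_const (c : C) : disc_algebra (fun _ => c).
Proof.
  apply disc_algebra_intro with (fun _ => c); [|reflexivity|].
  - intros x. apply Clim_const. typeclasses eauto.
  - intros z _. apply cdiff_const.
Qed.

Lemma disc_algebra_cdval : disc_algebra cdval.
Proof.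
  apply disc_algebra_intro with (fun z => z); [|reflexivity|].
  - apply Clim_cdval.
  - intros z _. apply cdiff_id.
Qed.

Lemma disc_algebra_plus (f g : closed_disc -> C) :
  disc_algebra f -> disc_algebra g -> disc_algebra (fun x => f x + g x)%C.
Proof.
  intros Hf Hg. apply disc_algebra_intro with (fun z => ext f z + ext g z)%C.
  - intros x. apply Clim_plus; [typeclasses eauto| |]; now apply disc_algebra_continuous.
  - intros x. now rewrite !ext_cdval.
  - intros z Hz. apply cdiff_plus; now apply disc_algebra_analytic.
Qed.

Lemma disc_algebra_mult (f g : closed_disc -> C) :
  disc_algebra f -> disc_algebra g -> disc_algebra (fun x => f x * g x)%C.
Proof.
  intros Hf Hg. apply disc_algebra_intro with (fun z => ext f z * ext g z)%C.
  - intros x. apply Clim_mult; [typeclasses eauto| |]; now apply disc_algebra_continuous.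
  - intros x. now rewrite !ext_cdval.
  - intros z Hz. apply cdiff_mult; now apply disc_algebra_analytic.
Qed.

Lemma disc_algebra_pow (f : closed_disc -> C) (n : nat) :
  disc_algebra f -> disc_algebra (fun x => f x ^ n)%C.
Proof.
  intros Hf. induction n as [|n IH]; simpl; [apply disc_algebra_const|now apply disc_algebra_mult].
Qed.

Lemma disc_algebra_inv (f : closed_disc -> C) :
  disc_algebra f -> (forall x, f x <> 0) -> disc_algebra (fun x => / f x)%C.
Proof.
  intros Hf N. apply disc_algebra_intro with (fun z => / ext f z)%C.
  - intros x. apply Clim_inv; [typeclasses eauto|apply N|now apply disc_algebra_continuous].
  - intros x. now rewrite !ext_cdval.
  - intros z Hz. apply cdiff_inv; [|now apply disc_algebra_analytic].
    change z with (cdval (exist _ z (Rlt_le _ _ Hz))). rewrite ext_cdval. apply N.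
Qed.

Lemma disc_algebra_comp (f : closed_disc -> C) (m : C -> C) (Phi : closed_disc -> closed_disc) :
  disc_algebra f -> (forall z, Cmod z <= 1 -> cdiff m z) ->
  (forall z, Cmod z < 1 -> Cmod (m z) < 1) -> (forall x, cdval (Phi x) = m (cdval x)) ->
  (forall x, continuous Phi x) /\ disc_algebra (fun x => f (Phi x)).
Proof.
  intros Hf Hm Hm1 HPhi.
  assert (HC : forall x, Clim (nearD x) (fun y => cdval (Phi y)) (cdval (Phi x))).
  { intros x. rewrite HPhi. apply Clim_ext with (fun y => m (cdval y)); [typeclasses eauto| |].
    - apply filter_forall. intros y. now rewrite HPhi.
    - apply Clim_comp; [typeclasses eauto|apply Clim_cdval|].
      apply cdiff_cont, Hm. apply (proj2_sig x). }
  split; [intros x; now apply continuous_disc_iff_Clim|].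
  apply disc_algebra_intro with (fun z => ext f (m z)).
  - intros x eps Heps.
    destruct (proj1 (nearD_iff _ _) (disc_algebra_continuous f (Phi x) Hf eps Heps)) as [d [Hd H]].
    generalize (HC x d Hd). apply filter_imp. intros y Hy. now apply H.
  - intros x. now rewrite <- HPhi, ext_cdval.
  - intros z Hz. apply (cdiff_comp m (ext f)); [apply Hm; lra|].
    apply disc_algebra_analytic; [exact Hf|now apply Hm1].
Qed.

Lemma disc_algebra_bounded (f : closed_disc -> C) : disc_algebra f ->
  exists B, forall x, Cmod (f x) <= B.
Proof.
  intros Hf. destruct (compact_bound (fun B z => Cmod (ext f z) <= B) 1) as [B HB].
  - intros B B' z; lra.
  - intros z Hz. pose (x := exist _ z Hz : closed_disc).
    destruct (proj1 (nearD_iff _ _) (Clim_bounded _ _ _ (disc_algebra_continuous f x Hf)))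
      as [d [Hd H]].
    exists (Cmod (f x) + 1). apply nearC_iff. exists d. split; [exact Hd|].
    intros y Hy Hy1. change y with (cdval (exist _ y Hy1)). rewrite ext_cdval.
    left. apply H. exact Hy.
  - exists B. intros x. rewrite <- ext_cdval. apply HB. apply (proj2_sig x).
Qed.

(** A point of the circle is first pulled radially into the open disc, then moved off the isolated
    zeros. *)
Lemma analytic_zeros_nowhere_dense (p : C -> C) (x : closed_disc) (P : closed_disc -> Prop) :
  analytic p -> (exists z, Cmod z < 1 /\ p z <> 0) -> nearD x P ->
  exists y, P y /\ Cmod (cdval y) < 1 /\ p (cdval y) <> 0.
Proof.
  intros Hp Np HP. destruct (proj1 (nearD_iff _ _) HP) as [d [Hd H]].
  set (e := Rmin (d / 2) (/ 2)).
  assert (He : 0 < e) by (apply Rmin_pos; lra).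
  pose proof (Rmin_l (d / 2) (/ 2)) as L1. pose proof (Rmin_r (d / 2) (/ 2)) as L2. fold e in L1, L2.
  pose proof (proj2_sig x : Cmod (cdval x) <= 1) as Hx. pose proof (Cmod_ge_0 (cdval x)).
  set (a := (RtoC (1 - e) * cdval x)%C).
  assert (Ha : Cmod a < 1) by (unfold a; rewrite Cmod_mult, Cmod_R, Rabs_pos_eq by lra; nra).
  assert (Hax : Cmod (a - cdval x) <= d / 2).
  { unfold a. replace (RtoC (1 - e) * cdval x - cdval x)%C with (- (RtoC e * cdval x))%C
      by (rewrite RtoC_minus; ring).
    rewrite Cmod_opp, Cmod_mult, Cmod_R, Rabs_pos_eq by lra. nra. }
  assert (He2 : 0 < d / 2) by lra.
  destruct (nearC_punctured_ex a _ (filter_and _ _ (analytic_isolated_zeros p Hp Np a Ha)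
    (filter_and _ _ (nearC_Cmod_lt a 1 Ha) (ccont_id a _ He2)))) as [y [Y1 [Y2 [Y3 Y4]]]].
  exists (exist _ y (Rlt_le _ _ Y3)). split; [|split; [exact Y3|now apply Y2]].
  apply H. simpl. replace (y - cdval x)%C with ((y - a) + (a - cdval x))%C by ring.
  eapply Rle_lt_trans; [apply Cmod_triangle|]. lra.
Qed.

(** Extends identities obtained by dividing by some function to its zeros and to the circle, by
    continuity. *)
Lemma eq_off_zeros (f g : closed_disc -> C) (p : C -> C) :
  (forall x, Clim (nearD x) f (f x)) -> (forall x, Clim (nearD x) g (g x)) ->
  analytic p -> (exists z, Cmod z < 1 /\ p z <> 0) ->
  (forall x, Cmod (cdval x) < 1 -> p (cdval x) <> 0 -> f x = g x) ->
  f = g.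
Proof.
  intros Hf Hg Hp Np H. apply functional_extensionality. intros x.
  apply NNPP. intros N. apply Cminus_eq_contra in N.
  assert (L : Clim (nearD x) (fun y => f y + - (1) * g y)%C (f x + - (1) * g x)%C).
  { apply Clim_plus; [typeclasses eauto|apply Hf|].
    apply Clim_mult; [typeclasses eauto|apply Clim_const; typeclasses eauto|apply Hg]. }
  replace (f x - g x)%C with (f x + - (1) * g x)%C in N by ring.
  destruct (analytic_zeros_nowhere_dense p x _ Hp Np (Clim_neq_0 _ _ _ N L)) as [y [Y1 [Y2 Y3]]].
  rewrite (H y Y2 Y3) in Y1.
  replace (g y + - (1) * g y)%C with (RtoC 0) in Y1 by ring.
  rewrite Cmod_0 in Y1. apply Cmod_gt_0 in N. lra.
Qed.

Lemma disc_algebra_nonzero (f : closed_disc -> C) : disc_algebra f ->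
  ~ (forall x, f x = 0) -> exists z, Cmod z < 1 /\ ext f z <> 0.
Proof.
  intros Hf N. apply NNPP. intros Hno. apply N.
  assert (E : f = (fun _ => RtoC 0)).
  { apply (eq_off_zeros f (fun _ => RtoC 0) (fun _ => RtoC 1)).
    - intros x. now apply disc_algebra_continuous.
    - intros x. apply Clim_const. typeclasses eauto.
    - intros z _. apply cdiff_const.
    - exists 0. rewrite Cmod_0. split; [lra|]. exact C1_nz.
    - intros x Hx _. apply NNPP. intros Nx. apply Hno. exists (cdval x).
      split; [exact Hx|]. now rewrite ext_cdval. }
  intros x. now rewrite E.
Qed.

Lemma disc_algebra_divide (f : closed_disc -> C) (a : closed_disc) :
  disc_algebra f -> Cmod (cdval a) < 1 -> f a = 0 ->
  exists h, disc_algebra h /\ f = (fun x => (cdval x - cdval a) * h x)%C.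
Proof.
  intros Hf Ha Fa. pose proof (disc_algebra_analytic f Hf) as Af.
  destruct (difference_quotient_cdiff (ext f) (cdval a) (analytic_near _ _ Af Ha))
    as [q [Q1 [Q2 Q3]]].
  assert (Eq : forall x, f x = ((cdval x - cdval a) * q (cdval x))%C).
  { intros x. rewrite <- (ext_cdval f x), Q1, ext_cdval, Fa. ring. }
  exists (fun x => q (cdval x)). split.
  - apply disc_algebra_intro with q; [|reflexivity|].
    + intros x. destruct (Ceq_dec (cdval x) (cdval a)) as [E|N].
      * apply Clim_comp; [typeclasses eauto|apply Clim_cdval|].
        rewrite E. now apply cdiff_cont.
      * apply Cminus_eq_contra in N.
        assert (L : Clim (nearD x) (fun y => cdval y + - cdval a)%C (cdval x + - cdval a)%C).
        { apply Clim_plus; [typeclasses eauto|apply Clim_cdval|apply Clim_const; typeclasses eauto]. }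
        replace (q (cdval x)) with (f x * / (cdval x + - cdval a))%C
          by (rewrite Eq; field; exact N).
        apply Clim_ext with (fun y => f y * / (cdval y + - cdval a))%C; [typeclasses eauto| |].
        -- generalize (Clim_neq_0 _ _ _ N L). apply filter_imp. intros y Hy.
           rewrite (Eq y). field. apply Cmod_gt_0. pose proof (Cmod_ge_0 (cdval x - cdval a)).
           unfold Cminus in *. lra.
        -- apply Clim_mult; [typeclasses eauto|now apply disc_algebra_continuous|].
           apply Clim_inv; [typeclasses eauto|exact N|exact L].
    + intros z Hz. destruct (Ceq_dec z (cdval a)) as [->|N]; [exact Q2|].
      apply Q3; [exact N|now apply Af].
  - apply functional_extensionality. exact Eq.
Qed.

(** * Characters of the disc algebra, without assuming continuity *)

Section Characters.
Context (chi : (closed_disc -> C) -> C)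
  (chi_plus : forall f g, disc_algebra f -> disc_algebra g ->
     chi (fun x => f x + g x)%C = (chi f + chi g)%C)
  (chi_scal : forall c f, disc_algebra f -> chi (fun x => c * f x)%C = (c * chi f)%C)
  (chi_mult : forall f g, disc_algebra f -> disc_algebra g ->
     chi (fun x => f x * g x)%C = (chi f * chi g)%C)
  (chi_one : chi (fun _ => RtoC 1) = RtoC 1).

Lemma character_const (c : C) : chi (fun _ => c) = c.
Proof.
  replace (fun _ : closed_disc => c) with (fun _ : closed_disc => (c * 1)%C)
    by (apply functional_extensionality; intros; ring).
  rewrite (chi_scal c (fun _ => RtoC 1)) by apply disc_algebra_const.
  rewrite chi_one. ring.
Qed.

(* Otherwise f - chi f would be invertible and in the kernel. *)
Lemma character_in_range (f : closed_disc -> C) : disc_algebra f -> exists x, chi f = f x.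
Proof.
  intros Hf. apply NNPP. intros Hno.
  pose (g := fun x => (f x + - chi f)%C).
  assert (Hg : disc_algebra g) by (apply disc_algebra_plus; [exact Hf|apply disc_algebra_const]).
  assert (Ng : forall x, g x <> 0).
  { intros x E. apply Hno. exists x. symmetry. apply Ceq_minus. exact E. }
  assert (E : chi (fun x => g x * / g x)%C = RtoC 1).
  { rewrite <- chi_one. f_equal. apply functional_extensionality. intros x. field. apply Ng. }
  rewrite (chi_mult g (fun x => / g x)%C) in E by (assumption || now apply disc_algebra_inv).
  unfold g at 1 in E.
  rewrite (chi_plus f (fun _ => - chi f)%C) in E by (assumption || apply disc_algebra_const).
  rewrite character_const in E.
  apply C1_nz. rewrite <- E. ring.
Qed.

Lemma character_pow (f : closed_disc -> C) (n : nat) :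
  disc_algebra f -> chi (fun x => f x ^ n)%C = (chi f ^ n)%C.
Proof.
  intros Hf. induction n as [|n IH]; simpl; [exact chi_one|].
  rewrite (chi_mult f (fun x => f x ^ n)%C) by (assumption || now apply disc_algebra_pow).
  now rewrite IH.
Qed.

(* The function p = (1 + conj(a) z) / 2 peaks at the boundary point a, where
   chi p = 1; so chi f = chi (p^n f) lies in the range of p^n f, which shrinks to 0. *)
Lemma character_boundary (f : closed_disc -> C) (a : closed_disc) :
  disc_algebra f -> Cmod (cdval a) = 1 -> chi cdval = cdval a -> f a = 0 -> chi f = 0.
Proof.
  intros Hf Ha Hchi Fa. apply NNPP. intros N. apply Cmod_gt_0 in N.
  pose (p := fun x : closed_disc => (/ 2 * (1 + Cconj (cdval a) * cdval x))%C).
  assert (Hp : disc_algebra p).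
  { apply disc_algebra_mult; [apply disc_algebra_const|].
    apply disc_algebra_plus; [apply disc_algebra_const|].
    apply disc_algebra_mult; [apply disc_algebra_const|apply disc_algebra_cdval]. }
  assert (N2 : RtoC 2 <> 0) by (intros E; apply RtoC_inj in E; lra).
  assert (Ca : (Cconj (cdval a) * cdval a)%C = 1).
  { rewrite Cmult_comm, <- Cmod2_conj, Ha. f_equal. ring. }
  assert (Cp : chi p = 1).
  { unfold p.
    rewrite (chi_scal _ (fun x => 1 + Cconj (cdval a) * cdval x)%C)
      by (apply disc_algebra_plus; [apply disc_algebra_const|];
          apply disc_algebra_mult; [apply disc_algebra_const|apply disc_algebra_cdval]).
    rewrite (chi_plus (fun _ => RtoC 1) (fun x => Cconj (cdval a) * cdval x)%C);
      [|apply disc_algebra_const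
       |apply disc_algebra_mult; [apply disc_algebra_const|apply disc_algebra_cdval]].
    rewrite chi_one, (chi_scal _ cdval), Hchi, Ca by apply disc_algebra_cdval.
    field. }
  (* As |a| = 1, the parallelogram law reads 4 |p x|^2 + |x - a|^2 = 2 + 2 |x|^2 <= 4. *)
  assert (Mp : forall x, Cmod (p x) ^ 2 <= 1 - Cmod (cdval x - cdval a) ^ 2 / 4).
  { intros x. pose proof (proj2_sig x : Cmod (cdval x) <= 1) as Hx.
    pose proof (Cmod_ge_0 (cdval x)).
    assert (A : Cmod (p x) ^ 2 * 4 + Cmod (cdval x - cdval a) ^ 2 =
      1 + Cmod (cdval a) ^ 2 * Cmod (cdval x) ^ 2 + Cmod (cdval a) ^ 2 + Cmod (cdval x) ^ 2).
    { unfold p. rewrite Cmod_mult, Rpow_mult_distr.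
      rewrite Cmod_inv, Cmod_R, Rabs_pos_eq by (exact N2 || lra).
      rewrite !Cmod2_alt. unfold Re, Im; simpl. field. }
    rewrite Ha in A. nra. }
  destruct (disc_algebra_bounded f Hf) as [B HB].
  destruct (proj1 (nearD_iff _ _) (disc_algebra_continuous f a Hf _ N)) as [d [Hd H]].
  assert (Key : forall n, Cmod (chi f) ^ 2 <= (1 - d ^ 2 / 4) ^ n * B ^ 2).
  { intros n.
    destruct (character_in_range (fun x => p x ^ n * f x)%C) as [x Hx].
    { apply disc_algebra_mult; [now apply disc_algebra_pow|exact Hf]. }
    rewrite (chi_mult (fun x => p x ^ n)%C f), character_pow, Cp, Cpow_1_l, Cmult_1_l in Hx
      by (assumption || now apply disc_algebra_pow).
    assert (Hfx : Cmod (chi f) ^ 2 = (Cmod (p x) ^ 2) ^ n * Cmod (f x) ^ 2).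
    { rewrite Hx, Cmod_mult, Cmod_pow, Rpow_mult_distr, <- !pow_mult. f_equal. f_equal. lia. }
    pose proof (Cmod_ge_0 (f x)). pose proof (HB x). pose proof (Mp x) as Mpx.
    assert (P0 : 0 <= Cmod (p x) ^ 2) by (apply pow2_ge_0).
    (* Within d of a one has |f| < |chi f| and |p| <= 1, so p^n f cannot take the value chi f
       there. *)
    assert (Far : d <= Cmod (cdval x - cdval a)).
    { apply Rnot_lt_le. intros Hlt. specialize (H x Hlt).
      replace (f x - f a)%C with (f x) in H by (rewrite Fa; ring).
      assert ((Cmod (p x) ^ 2) ^ n <= 1).
      { rewrite <- (pow1 n). apply pow_incr. split; [exact P0|].
        pose proof (pow2_ge_0 (Cmod (cdval x - cdval a))). lra. }
      assert (0 <= Cmod (f x) ^ 2) by apply pow2_ge_0.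
      assert (Cmod (chi f) ^ 2 <= Cmod (f x) ^ 2) by nra.
      nra. }
    rewrite Hfx. apply Rmult_le_compat; [now apply pow_le|apply pow2_ge_0| |].
    - apply pow_incr. split; [exact P0|].
      assert (d ^ 2 <= Cmod (cdval x - cdval a) ^ 2) by (apply pow_incr; lra). lra.
    - apply pow_incr. lra. }
  assert (K0 := Key 0%nat). assert (K1 := Key 1%nat). simpl pow in K0, K1.
  assert (P : 0 < Cmod (chi f) ^ 2) by (apply pow_lt; exact N). simpl pow in P.
  (* Otherwise [Key] with exponent 1 would give chi f = 0. *)
  assert (Q : 0 < 1 - d ^ 2 / 4).
  { apply Rnot_le_lt. intros Hle. simpl pow in Hle. nra. }
  apply (pow_unbounded_contra (Cmod (chi f) ^ 2) (B ^ 2) (/ (1 - d ^ 2 / 4))).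
  - exact P.
  - rewrite <- Rinv_1. apply Rinv_lt_contravar; [lra|]. assert (0 < d ^ 2) by (apply pow_lt; lra). lra.
  - intros n. rewrite pow_inv. apply Rle_div_l; [now apply pow_lt|].
    rewrite Rmult_comm. apply Key.
Qed.

Lemma character_evaluation : exists a, forall f, disc_algebra f -> chi f = f a.
Proof.
  destruct (character_in_range cdval disc_algebra_cdval) as [a Ea].
  exists a. intros f Hf.
  pose (g := fun x => (f x + - f a)%C).
  assert (Hg : disc_algebra g) by (apply disc_algebra_plus; [exact Hf|apply disc_algebra_const]).
  assert (Ga : g a = 0) by (unfold g; ring).
  assert (E : chi g = 0).
  { destruct (proj2_sig a : Cmod (cdval a) <= 1) as [Hlt|Heq].
    - destruct (disc_algebra_divide g a Hg Hlt Ga) as [h [H1 H2]]. rewrite H2. unfold Cminus.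
      rewrite (chi_mult (fun x => cdval x + - cdval a)%C h);
        [|apply disc_algebra_plus; [apply disc_algebra_cdval|apply disc_algebra_const]|exact H1].
      rewrite (chi_plus cdval (fun _ => - cdval a)%C) by
        (apply disc_algebra_cdval || apply disc_algebra_const).
      rewrite character_const, Ea. ring.
    - now apply character_boundary with a. }
  unfold g in E. rewrite (chi_plus f (fun _ => - f a)%C) in E by (assumption || apply disc_algebra_const).
  rewrite character_const in E. now apply Ceq_minus.
Qed.

End Characters.

(** * Automorphisms of principal ideals *)

Lemma principal_ideal_disc_algebra (psi h : closed_disc -> C) :
  disc_algebra psi -> principal_ideal psi h -> disc_algebra h.
Proof. intros Hpsi [f [Hf ->]]. now apply disc_algebra_mult. Qed.

Lemma principal_ideal_intro (psi f : closed_disc -> C) :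
  disc_algebra f -> principal_ideal psi (fun x => psi x * f x)%C.
Proof. intros Hf. now exists f. Qed.

Lemma principal_ideal_self (psi : closed_disc -> C) : principal_ideal psi psi.
Proof.
  exists (fun _ => RtoC 1). split; [apply disc_algebra_const|].
  apply functional_extensionality. intros x. ring.
Qed.

Lemma principal_ideal_plus (psi f g : closed_disc -> C) :
  principal_ideal psi f -> principal_ideal psi g -> principal_ideal psi (fun x => f x + g x)%C.
Proof.
  intros [f' [Hf ->]] [g' [Hg ->]]. exists (fun x => f' x + g' x)%C.
  split; [now apply disc_algebra_plus|]. apply functional_extensionality. intros x. ring.
Qed.

Lemma principal_ideal_mult (psi f g : closed_disc -> C) :
  disc_algebra f -> principal_ideal psi g -> principal_ideal psi (fun x => f x * g x)%C.
Proof.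
  intros Hf [g' [Hg ->]]. exists (fun x => f x * g' x)%C.
  split; [now apply disc_algebra_mult|]. apply functional_extensionality. intros x. ring.
Qed.

Lemma automorphism_inverse (psi : closed_disc -> C)
    (T : (closed_disc -> C) -> (closed_disc -> C)) :
  disc_algebra psi -> algebra_automorphism_on (principal_ideal psi) T ->
  exists S, algebra_automorphism_on (principal_ideal psi) S /\
    (forall h, principal_ideal psi h -> T (S h) = h) /\
    (forall h, principal_ideal psi h -> S (T h) = h).
Proof.
  intros Hpsi [[Hmaps [Hinj Hsurj]] [Hplus [Hscal Hmult]]].
  pose (B := principal_ideal psi).
  (* The guard makes the choice total; outside the ideal the value of [S] is arbitrary. *)
  assert (HS : forall y, exists x, B y -> B x /\ T x = y).
  { intros y. destruct (classic (B y)) as [Hy|Hy].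
    - destruct (Hsurj y Hy) as [x Hx]. now exists x.
    - exists y. intros Hy'. contradiction. }
  pose (S := fun y => proj1_sig (constructive_indefinite_description _ (HS y))).
  assert (Spec : forall y, B y -> B (S y) /\ T (S y) = y).
  { intros y. apply (proj2_sig (constructive_indefinite_description _ (HS y))). }
  assert (ST : forall x, B x -> S (T x) = x).
  { intros x Hx. destruct (Spec (T x) (Hmaps x Hx)) as [H1 H2]. now apply Hinj. }
  assert (Uniq : forall x y, B x -> T x = y -> S y = x).
  { intros x y Hx <-. now apply ST. }
  assert (TS : forall y, B y -> T (S y) = y) by (intros y Hy; now apply Spec).
  assert (SB : forall y, B y -> B (S y)) by (intros y Hy; now apply Spec).
  assert (DA : forall y, B y -> disc_algebra y) by (intros y; now apply principal_ideal_disc_algebra).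
  exists S. split; [|split; assumption].
  split; [split; [exact SB|split]|split; [|split]].
  - intros x y Hx Hy E. rewrite <- (TS x Hx), <- (TS y Hy). now f_equal.
  - intros x Hx. exists (T x). split; [now apply Hmaps|now apply ST].
  - intros f g Hf Hg. apply Uniq; [apply principal_ideal_plus; now apply SB|].
    rewrite Hplus, !TS; auto; now apply SB.
  - intros c f Hf. apply Uniq.
    + apply principal_ideal_mult; [apply disc_algebra_const|now apply SB].
    + rewrite Hscal, TS; auto. now apply SB.
  - intros f g Hf Hg. apply Uniq.
    + apply principal_ideal_mult; [now apply DA, SB|now apply SB].
    + rewrite Hmult, !TS; auto; now apply SB.
Qed.

Section Automorphism.
Context (psi : closed_disc -> C) (Hpsi : disc_algebra psi)
  (Npsi : ~ (forall x, psi x = RtoC 0))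
  (T : (closed_disc -> C) -> (closed_disc -> C))
  (HT : algebra_automorphism_on (principal_ideal psi) T).

Lemma automorphism_maps (h : closed_disc -> C) :
  principal_ideal psi h -> principal_ideal psi (T h).
Proof. apply HT. Qed.

Lemma automorphism_point (w : closed_disc) : T psi w <> 0 ->
  exists x, forall h, principal_ideal psi h -> T h w = h x.
Proof.
  intros Nw. destruct HT as [[Hmaps _] [Hplus [Hscal Hmult]]].
  assert (Hself := principal_ideal_self psi).
  pose (chi := fun f => (T (fun x => psi x * f x) w / T psi w)%C).
  destruct (character_evaluation chi) as [x Hx].
  - intros f g Hf Hg. unfold chi.
    replace (fun x => psi x * (f x + g x))%C with (fun x => psi x * f x + psi x * g x)%C
      by (apply functional_extensionality; intros; ring).
    rewrite Hplus by now apply principal_ideal_intro. field. exact Nw.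
  - intros c f Hf. unfold chi.
    replace (fun x => psi x * (c * f x))%C with (fun x => c * (psi x * f x))%C
      by (apply functional_extensionality; intros; ring).
    rewrite Hscal by now apply principal_ideal_intro. field. exact Nw.
  - intros f g Hf Hg. unfold chi.
    (* One factor psi is not enough to split the product f g inside the ideal. With a second one, T
       psi * T (psi f g) = T (psi f) * T (psi g). *)
    assert (E : T (fun x => psi x * (psi x * (f x * g x)))%C =
      T (fun x => (psi x * f x) * (psi x * g x))%C)
      by (f_equal; apply functional_extensionality; intros; ring).
    rewrite (Hmult psi (fun x => psi x * (f x * g x))%C) in E
      by (exact Hself || now apply principal_ideal_intro, disc_algebra_mult).
    rewrite (Hmult (fun x => psi x * f x)%C (fun x => psi x * g x)%C) in E
      by now apply principal_ideal_intro.
    apply (f_equal (fun h => h w)) in E.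
    replace (T (fun x => psi x * (f x * g x)) w / T psi w)%C with
      ((T psi w * T (fun x => psi x * (f x * g x)) w) / (T psi w * T psi w))%C
      by (field; exact Nw).
    rewrite E. field. exact Nw.
  - unfold chi. replace (fun x => psi x * 1)%C with psi
      by (apply functional_extensionality; intros; ring).
    field. exact Nw.
  - exists x. intros h Hh.
    (* An h of the ideal is also an element of A(D), and T (psi h) = T psi * T h shows that chi h =
       T h w. *)
    rewrite <- (Hx h) by now apply (principal_ideal_disc_algebra psi).
    unfold chi. rewrite Hmult by assumption. field. exact Nw.
Qed.

Lemma automorphism_injective_0 (h : closed_disc -> C) :
  principal_ideal psi h -> (forall x, T h x = 0) -> forall x, h x = 0.
Proof.
  intros Hh H0. destruct HT as [[_ [Hinj _]] [_ [Hscal _]]].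
  pose (z := fun x => (0 * h x)%C).
  assert (E : h = z).
  { apply Hinj; [exact Hh|apply principal_ideal_mult; [apply disc_algebra_const|exact Hh]|].
    unfold z. rewrite Hscal by exact Hh. apply functional_extensionality. intros x.
    rewrite H0. ring. }
  intros x. rewrite E. unfold z. ring.
Qed.

Lemma automorphism_psi_nonzero : exists z, Cmod z < 1 /\ ext (T psi) z <> 0.
Proof.
  apply disc_algebra_nonzero.
  - apply (principal_ideal_disc_algebra psi); [exact Hpsi|].
    apply automorphism_maps, principal_ideal_self.
  - intros H. apply Npsi. apply automorphism_injective_0; [apply principal_ideal_self|exact H].
Qed.

End Automorphism.

(** * The symbol of an automorphism *)

(** The zeros of p are isolated, so near each of them only one value has to be assigned, and all can
    be treated at once by choice. *)
Lemma bounded_analytic_extension (f p : C -> C) (B : R) :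
  analytic p -> (exists z, Cmod z < 1 /\ p z <> 0) ->
  (forall z, Cmod z < 1 -> p z <> 0 -> cdiff f z) ->
  (forall z, Cmod z < 1 -> p z <> 0 -> Cmod (f z) <= B) ->
  exists g, analytic g /\ (forall z, p z <> 0 -> g z = f z) /\
    forall z, Cmod z < 1 -> Cmod (g z) <= B.
Proof.
  intros Hp Np Hf HB.
  (* The values of f at zeros of p are unconstrained; setting them to 0 makes the bound B valid at
     every point of the disc. *)
  pose (f0 := fun z => if Ceq_dec (p z) 0 then RtoC 0 else f z).
  assert (HB0 : 0 <= B).
  { destruct Np as [z [H1 H2]]. eapply Rle_trans; [apply Cmod_ge_0|now apply (HB z)]. }
  assert (Hf0 : forall z, p z <> 0 -> f0 z = f z).
  { intros z N. unfold f0. destruct (Ceq_dec (p z) 0); [contradiction|reflexivity]. }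
  assert (Pn : forall z, Cmod z < 1 -> p z <> 0 -> nearC z (fun y => p y <> 0)).
  { intros z Hz N. generalize (Clim_neq_0 _ _ _ N (cdiff_cont p z (Hp z Hz))).
    apply filter_imp. intros y Hy. apply Cmod_gt_0. pose proof (Cmod_ge_0 (p z)). lra. }
  assert (Df0 : forall z, Cmod z < 1 -> p z <> 0 -> cdiff f0 z).
  { intros z Hz N. apply cdiff_ext with f; [|now apply Hf].
    generalize (Pn z Hz N). apply filter_imp. intros y Hy. symmetry. now apply Hf0. }
  assert (HL : forall z, exists L, Cmod z < 1 -> cdiff (fun y => if Ceq_dec y z then L else f0 y) z).
  { intros z. destruct (Rlt_le_dec (Cmod z) 1) as [Hz|Hz]; [|exists 0; lra].
    destruct (bounded_singularity f0 z B) as [L HL].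
    - generalize (filter_and _ _ (nearC_Cmod_lt z 1 Hz) (analytic_isolated_zeros p Hp Np z Hz)).
      apply filter_imp. intros y [Y1 Y2] Ny. apply Df0; auto.
    - generalize (nearC_Cmod_lt z 1 Hz). apply filter_imp. intros y Hy.
      unfold f0. destruct (Ceq_dec (p y) 0) as [E|N]; [now rewrite Cmod_0|now apply HB].
    - exists L. auto. }
  pose (L := fun z => proj1_sig (constructive_indefinite_description _ (HL z))).
  assert (HL' : forall z, Cmod z < 1 -> cdiff (fun y => if Ceq_dec y z then L z else f0 y) z).
  { intros z. apply (proj2_sig (constructive_indefinite_description _ (HL z))). }
  pose (g := fun z => if Ceq_dec (p z) 0 then L z else f z).
  assert (Hg : forall z, p z <> 0 -> g z = f z).
  { intros z N. unfold g. destruct (Ceq_dec (p z) 0); [contradiction|reflexivity]. }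
  assert (Ag : analytic g).
  { intros z Hz. destruct (Ceq_dec (p z) 0) as [E|N].
    - apply cdiff_ext with (fun y => if Ceq_dec y z then L z else f0 y); [|now apply HL'].
      generalize (analytic_isolated_zeros p Hp Np z Hz). apply filter_imp. intros y Hy.
      destruct (Ceq_dec y z) as [->|Ny].
      + unfold g. destruct (Ceq_dec (p z) 0); [reflexivity|contradiction].
      + rewrite Hg, Hf0 by now apply Hy. reflexivity.
    - apply cdiff_ext with f; [|now apply Hf].
      generalize (Pn z Hz N). apply filter_imp. intros y Hy. symmetry. now apply Hg. }
  exists g. split; [exact Ag|]. split; [exact Hg|].
  intros z Hz. apply (Clim_Cmod_le (nearC' z) g).
  - typeclasses eauto.
  - intros eps Heps. unfold nearC', within.
    generalize (cdiff_cont g z (Ag z Hz) eps Heps). now apply filter_imp.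
  - unfold nearC', within.
    generalize (filter_and _ _ (nearC_Cmod_lt z 1 Hz) (analytic_isolated_zeros p Hp Np z Hz)).
    apply filter_imp. intros y [Y1 Y2] Ny. rewrite Hg by now apply Y2. apply HB; auto.
Qed.

Lemma analytic_disc_range (f : C -> C) (w : C) : analytic f ->
  (forall z, Cmod z < 1 -> Cmod (f z) <= 1) -> Cmod w < 1 -> Cmod (f w) = 1 ->
  forall z, Cmod z < 1 -> f z = f w.
Proof.
  intros Hf F1 Hw Fw z Hz.
  pose proof (strong_max_principle (fun z => f (mob w z)) (analytic_mob f w Hw Hf)) as H.
  cbv beta in H. rewrite mob_0 in H.
  rewrite <- (mob_inv' w z Hw ltac:(lra)). apply H; [exact Fw| |].
  - intros y Hy. now apply F1, mob_disc.
  - apply mob_disc; [now rewrite Cmod_opp|exact Hz].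
Qed.

(** Where T psi does not vanish, the quotient T (psi z) / T psi is the point of evaluation, so it is
    bounded by 1. A value c on the circle would make phi constant; then T would send (z - c) psi, a
    nonzero element, to 0. *)
Lemma automorphism_symbol (psi : closed_disc -> C) (T : (closed_disc -> C) -> (closed_disc -> C)) :
  disc_algebra psi -> ~ (forall x, psi x = RtoC 0) ->
  algebra_automorphism_on (principal_ideal psi) T ->
  exists phi, analytic phi /\ (forall z, Cmod z < 1 -> Cmod (phi z) < 1) /\
    forall w x, T psi w <> 0 -> cdval x = phi (cdval w) ->
      forall h, principal_ideal psi h -> T h w = h x.
Proof.
  intros Hpsi Npsi HT.
  assert (DA : forall h, principal_ideal psi h -> disc_algebra (T h)).
  { intros h Hh. apply (principal_ideal_disc_algebra psi); [exact Hpsi|].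
    now apply automorphism_maps. }
  assert (Hself := principal_ideal_self psi).
  assert (Hid : principal_ideal psi (fun x => psi x * cdval x)%C)
    by apply principal_ideal_intro, disc_algebra_cdval.
  assert (Np := automorphism_psi_nonzero psi Hpsi Npsi T HT).
  assert (Ap := disc_algebra_analytic _ (DA _ Hself)).
  assert (As := disc_algebra_analytic _ (DA _ Hid)).
  pose (f := fun z => (ext (T (fun x => psi x * cdval x)%C) z / ext (T psi) z)%C).
  assert (Ff : forall w x, T psi w <> 0 ->
    (forall h, principal_ideal psi h -> T h w = h x) -> f (cdval w) = cdval x).
  { intros w x Nw H. unfold f. rewrite !ext_cdval, (H _ Hid), (H _ Hself).
    field. now rewrite <- (H _ Hself). }
  destruct (bounded_analytic_extension f (ext (T psi)) 1 Ap Np) as [phi [P1 [P2 P3]]].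
  { intros z Hz N. apply cdiff_div; auto. }
  { intros z Hz N. pose (w := exist _ z (Rlt_le _ _ Hz) : closed_disc).
    change z with (cdval w) in N |- *. rewrite ext_cdval in N.
    destruct (automorphism_point psi Hpsi T HT w N) as [x Hx].
    rewrite (Ff w x N Hx). apply (proj2_sig x). }
  assert (Hphi : forall w x, T psi w <> 0 -> cdval x = phi (cdval w) ->
      forall h, principal_ideal psi h -> T h w = h x).
  { intros w x Nw E. destruct (automorphism_point psi Hpsi T HT w Nw) as [y Hy].
    replace x with y; [exact Hy|]. apply cdval_inj. rewrite E, P2 by now rewrite ext_cdval.
    symmetry. now apply Ff. }
  exists phi. split; [exact P1|]. split; [|exact Hphi].
  intros z Hz. destruct (P3 z Hz) as [Hlt|Heq]; [exact Hlt|exfalso].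
  assert (Hc : forall y, Cmod y < 1 -> phi y = phi z) by now apply analytic_disc_range.
  pose (x := exist _ (phi z) (P3 z Hz) : closed_disc).
  pose (h := fun y => ((cdval y + - phi z) * psi y)%C).
  assert (Hh : principal_ideal psi h).
  { apply principal_ideal_mult; [|exact Hself].
    apply disc_algebra_plus; [apply disc_algebra_cdval|apply disc_algebra_const]. }
  assert (E : T h = (fun _ => RtoC 0)).
  { apply (eq_off_zeros _ _ (ext (T psi))); [| |exact Ap|exact Np|].
    - intros w. now apply disc_algebra_continuous, DA.
    - intros w. apply Clim_const. typeclasses eauto.
    - intros w Hw Nw. rewrite ext_cdval in Nw.
      rewrite (Hphi w x Nw) by (exact Hh || (simpl; symmetry; now apply Hc)).
      unfold h, x. simpl. ring. }
  assert (H0 := automorphism_injective_0 psi T HT h Hh ltac:(intros y; now rewrite E)).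
  destruct (disc_algebra_nonzero psi Hpsi Npsi) as [y [Hy Ny]].
  pose (y' := exist _ y (Rlt_le _ _ Hy) : closed_disc).
  change y with (cdval y') in Ny. rewrite ext_cdval in Ny.
  specialize (H0 y'). unfold h in H0. revert H0. apply Cmult_neq_0; [|exact Ny].
  apply (Cminus_eq_contra y (phi z)). intros E'. rewrite <- E' in Heq. lra.
Qed.

Lemma analytic_mult_nonzero (p q : C -> C) : analytic p -> analytic q ->
  (exists z, Cmod z < 1 /\ p z <> 0) -> (exists z, Cmod z < 1 /\ q z <> 0) ->
  exists z, Cmod z < 1 /\ (p z * q z)%C <> 0.
Proof.
  intros Hp Hq Np Nq. assert (H0 : Cmod 0 < 1) by (rewrite Cmod_0; lra).
  destruct (nearC_punctured_ex 0 _ (filter_and _ _ (nearC_Cmod_lt 0 1 H0) (filter_and _ _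
    (analytic_isolated_zeros p Hp Np 0 H0) (analytic_isolated_zeros q Hq Nq 0 H0))))
    as [z [Z0 [Z1 [Z2 Z3]]]].
  exists z. split; [exact Z1|]. apply Cmult_neq_0; auto.
Qed.

(** The product f p vanishes on the disc, and analytic functions there have no zero divisors. *)
Lemma analytic_eq_off_zeros (f p : C -> C) : analytic f -> analytic p ->
  (exists z, Cmod z < 1 /\ p z <> 0) ->
  (forall z, Cmod z < 1 -> p z <> 0 -> f z = 0) ->
  forall z, Cmod z < 1 -> f z = 0.
Proof.
  intros Hf Hp Np H z Hz. apply NNPP. intros N.
  destruct (analytic_mult_nonzero f p Hf Hp) as [y [Hy Ny]]; [now exists z|exact Np|].
  apply Ny. destruct (Ceq_dec (p y) 0) as [->|Npy]; [ring|]. rewrite H by assumption. ring.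
Qed.

(** Off the zeros of psi and T psi, h(w) = T (S h)(w) = (S h)(phi w) = h(eta(phi w)) for all h in
    the ideal; psi and psi z together determine the point w. *)
Lemma automorphism_symbol_inverse (psi : closed_disc -> C)
    (T S : (closed_disc -> C) -> (closed_disc -> C)) (phi eta : C -> C) :
  disc_algebra psi -> ~ (forall x, psi x = RtoC 0) ->
  algebra_automorphism_on (principal_ideal psi) T ->
  algebra_automorphism_on (principal_ideal psi) S ->
  (forall h, principal_ideal psi h -> T (S h) = h) ->
  analytic phi -> (forall z, Cmod z < 1 -> Cmod (phi z) < 1) ->
  analytic eta -> (forall z, Cmod z < 1 -> Cmod (eta z) < 1) ->
  (forall w x, T psi w <> 0 -> cdval x = phi (cdval w) ->
    forall h, principal_ideal psi h -> T h w = h x) ->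
  (forall w x, S psi w <> 0 -> cdval x = eta (cdval w) ->
    forall h, principal_ideal psi h -> S h w = h x) ->
  forall z, Cmod z < 1 -> eta (phi z) = z.
Proof.
  intros Hpsi Npsi HT HS HTS Aphi Dphi Aeta Deta Hphi Heta.
  assert (Hself := principal_ideal_self psi).
  assert (Atp : analytic (ext (T psi))).
  { apply disc_algebra_analytic, (principal_ideal_disc_algebra psi); [exact Hpsi|].
    now apply automorphism_maps. }
  assert (Ap := disc_algebra_analytic psi Hpsi).
  intros z Hz. apply Ceq_minus. revert z Hz.
  apply (analytic_eq_off_zeros _ (fun z => ext (T psi) z * ext psi z)%C).
  - intros z Hz. apply cdiff_minus; [|apply cdiff_id].
    apply (cdiff_comp phi eta); auto.
  - intros z Hz. apply cdiff_mult; auto.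
  - apply analytic_mult_nonzero; auto; [now apply automorphism_psi_nonzero|].
    now apply disc_algebra_nonzero.
  - intros z Hz N.
    pose (w := exist _ z (Rlt_le _ _ Hz) : closed_disc).
    pose (x := exist _ (phi z) (Rlt_le _ _ (Dphi z Hz)) : closed_disc).
    pose (y := exist _ (eta (phi z)) (Rlt_le _ _ (Deta _ (Dphi z Hz))) : closed_disc).
    change z with (cdval w) in N. rewrite !ext_cdval in N.
    assert (N1 : T psi w <> 0) by (intros E; apply N; rewrite E; ring).
    assert (N2 : psi w <> 0) by (intros E; apply N; rewrite E; ring).
    assert (Hx : forall h, principal_ideal psi h -> h w = S h x).
    { intros h Hh. transitivity (T (S h) w); [now rewrite HTS|].
      apply Hphi; [exact N1|reflexivity|]. now apply automorphism_maps. }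
    assert (Hy : forall h, principal_ideal psi h -> h w = h y).
    { intros h Hh. rewrite (Hx h Hh). apply Heta; [|reflexivity|exact Hh].
      now rewrite <- Hx. }
    assert (E := Hy _ (principal_ideal_intro psi cdval disc_algebra_cdval)).
    cbv beta in E. rewrite <- (Hy psi Hself) in E.
    change (cdval y - cdval w = 0)%C.
    replace (cdval y - cdval w)%C with
      ((psi w * cdval y - psi w * cdval w) / psi w)%C by (field; exact N2).
    rewrite <- E. unfold Cdiv. ring.
Qed.

(** * Automorphisms of the closed disc *)

(** The poles of the Moebius maps lie outside the closed disc, so differentiability can be asked on
    the circle too; continuity of [Phi] there follows from it. *)
Definition disc_map (m : C -> C) (Phi : closed_disc -> closed_disc) : Prop :=
  (forall z, Cmod z <= 1 -> cdiff m z) /\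
  (forall z, Cmod z < 1 -> Cmod (m z) < 1) /\
  (forall x, cdval (Phi x) = m (cdval x)).

Lemma disc_map_intro (m : C -> C) :
  (forall z, Cmod z <= 1 -> cdiff m z) -> (forall z, Cmod z < 1 -> Cmod (m z) < 1) ->
  (forall z, Cmod z <= 1 -> Cmod (m z) <= 1) -> exists Phi, disc_map m Phi.
Proof.
  intros H1 H2 H3.
  exists (fun x => exist _ (m (cdval x)) (H3 _ (proj2_sig x)) : closed_disc).
  split; [exact H1|]. split; [exact H2|reflexivity].
Qed.

Lemma disc_automorphism_disc_map (phi : C -> C) : disc_automorphism phi ->
  exists m n Phi Psi, disc_map m Phi /\ disc_map n Psi /\
    (forall z, Cmod z < 1 -> phi z = m z) /\
    (forall x, Phi (Psi x) = x) /\ (forall x, Psi (Phi x) = x).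
Proof.
  intros Hphi. destruct (disc_automorphism_mob phi Hphi) as [a [c [Ha [Hc Heq]]]].
  assert (Nc : c <> 0) by (apply Cmod_gt_0; lra).
  assert (Hma : Cmod (- a) < 1) by now rewrite Cmod_opp.
  assert (Hzc : forall z, Cmod (z / c) = Cmod z).
  { intros z. rewrite Cmod_div, Hc by exact Nc. field. }
  destruct (disc_map_intro (fun z => c * mob a z)%C) as [Phi HPhi].
  { intros z Hz. apply cdiff_mult; [apply cdiff_const|now apply cdiff_mob]. }
  { intros z Hz. rewrite Cmod_mult, Hc, Rmult_1_l. now apply mob_disc. }
  { intros z Hz. rewrite Cmod_mult, Hc, Rmult_1_l. now apply mob_closed_disc. }
  destruct (disc_map_intro (fun z => mob (- a) (z / c))) as [Psi HPsi].
  { intros z Hz. apply (cdiff_comp (fun z => z / c)%C (mob (- a))).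
    - apply cdiff_mult; [apply cdiff_id|apply cdiff_const].
    - apply cdiff_mob; [exact Hma|now rewrite Hzc]. }
  { intros z Hz. apply mob_disc; [exact Hma|now rewrite Hzc]. }
  { intros z Hz. apply mob_closed_disc; [exact Hma|now rewrite Hzc]. }
  exists (fun z => c * mob a z)%C, (fun z => mob (- a) (z / c)), Phi, Psi.
  split; [exact HPhi|]. split; [exact HPsi|]. split; [exact Heq|].
  split; intros x; apply cdval_inj;
    rewrite ?(proj2 (proj2 HPhi)), ?(proj2 (proj2 HPsi)), ?(proj2 (proj2 HPhi)).
  - rewrite mob_inv' by (exact Ha || rewrite Hzc; apply (proj2_sig x)).
    field. exact Nc.
  - replace (c * mob a (cdval x) / c)%C with (mob a (cdval x)) by (field; exact Nc).
    apply mob_inv; [exact Ha|apply (proj2_sig x)].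
Qed.

Lemma disc_map_comp (f : closed_disc -> C) (m : C -> C) (Phi : closed_disc -> closed_disc) :
  disc_map m Phi -> disc_algebra f -> disc_algebra (fun x => f (Phi x)).
Proof. intros [H1 [H2 H3]] Hf. now apply (disc_algebra_comp f m). Qed.

Lemma disc_map_continuous (m : C -> C) (Phi : closed_disc -> closed_disc) :
  disc_map m Phi -> forall x, continuous Phi x.
Proof.
  intros [H1 [H2 H3]]. now apply (disc_algebra_comp cdval m Phi disc_algebra_cdval).
Qed.

Lemma continuous_extension_unique (phi m : C -> C) (Phi Phi' : closed_disc -> closed_disc) :
  continuous_extension phi Phi -> disc_map m Phi' ->
  (forall z, Cmod z < 1 -> phi z = m z) -> Phi = Phi'.
Proof.
  intros [HC HE] Hm Heq.
  assert (E : (fun x => cdval (Phi x)) = (fun x => cdval (Phi' x))).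
  { apply (eq_off_zeros _ _ (fun _ => RtoC 1)).
    - intros x. now apply continuous_disc_iff_Clim.
    - intros x. apply continuous_disc_iff_Clim. now apply (disc_map_continuous m).
    - intros z _. apply cdiff_const.
    - exists 0. rewrite Cmod_0. split; [lra|exact C1_nz].
    - intros x Hx _. rewrite HE by exact Hx. rewrite (proj2 (proj2 Hm)). now apply Heq. }
  apply functional_extensionality. intros x. apply cdval_inj.
  exact (f_equal (fun h => h x) E).
Qed.

(** * The two implications *)

Lemma automorphism_of_composition (psi : closed_disc -> C)
    (T : (closed_disc -> C) -> (closed_disc -> C))
    (phi : C -> C) (Phi : closed_disc -> closed_disc) (g : closed_disc -> C) :
  disc_algebra psi -> maps_into (principal_ideal psi) T ->
  disc_automorphism phi -> continuous_extension phi Phi ->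
  (forall f, principal_ideal psi f -> T f = composition_operator Phi f) ->
  disc_algebra_invertible g ->
  composition_operator Phi psi = (fun z => psi z * g z)%C ->
  algebra_automorphism_on (principal_ideal psi) T.
Proof.
  intros Hpsi Hmaps Hphi Hext HT [Hg [h [Hh Hgh]]] Hpg.
  destruct (disc_automorphism_disc_map phi Hphi) as (m & n & Phi' & Psi & Hm & Hn & Heq & Hinv & Hinv').
  (* The given extension is identified with the Moebius one, which has an inverse on the closed
     disc. *)
  rewrite <- (continuous_extension_unique phi m Phi Phi' Hext Hm Heq) in *.
  assert (DA : forall f, principal_ideal psi f -> disc_algebra f).
  { intros f. now apply principal_ideal_disc_algebra. }
  split; [split; [exact Hmaps|split]|split; [|split]].
  - intros x y Hx Hy E. rewrite !HT in E by assumption.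
    apply functional_extensionality. intros z. rewrite <- (Hinv z).
    exact (f_equal (fun f => f (Psi z)) E).
  - intros y [f [Hf ->]].
    (* A preimage of psi f is psi times (f h) o Phi^-1: composing with Phi gives psi g f h = psi
       f. *)
    assert (Hk : disc_algebra (fun x => f (Psi x) * h (Psi x))%C).
    { apply (disc_map_comp (fun x => f x * h x)%C n Psi Hn). now apply disc_algebra_mult. }
    exists (fun x => psi x * (f (Psi x) * h (Psi x)))%C.
    split; [now apply (principal_ideal_intro psi (fun x => f (Psi x) * h (Psi x))%C)|].
    rewrite HT by now apply (principal_ideal_intro psi (fun x => f (Psi x) * h (Psi x))%C).
    apply functional_extensionality. intros z. unfold composition_operator.
    assert (E : psi (Phi z) = (psi z * g z)%C) by exact (f_equal (fun f => f z) Hpg).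
    rewrite Hinv', E.
    replace (psi z * g z * (f z * h z))%C with (psi z * f z * (g z * h z))%C by ring.
    rewrite Hgh. ring.
  - intros f f' Hf Hf'. rewrite !HT; auto. now apply principal_ideal_plus.
  - intros c f Hf. rewrite !HT; auto. apply principal_ideal_mult; [apply disc_algebra_const|exact Hf].
  - intros f f' Hf Hf'. rewrite !HT; auto. apply principal_ideal_mult; auto.
Qed.

Lemma composition_of_automorphism (psi : closed_disc -> C)
    (T : (closed_disc -> C) -> (closed_disc -> C)) :
  disc_algebra psi -> ~ (forall x, psi x = RtoC 0) ->
  algebra_automorphism_on (principal_ideal psi) T ->
  exists (phi : C -> C) (Phi : closed_disc -> closed_disc),
    disc_automorphism phi /\ continuous_extension phi Phi /\
    (forall f, principal_ideal psi f -> T f = composition_operator Phi f) /\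
    exists g, disc_algebra_invertible g /\
      composition_operator Phi psi = (fun z => psi z * g z)%C.
Proof.
  intros Hpsi Npsi HT.
  destruct (automorphism_inverse psi T Hpsi HT) as [S [HS [TS ST]]].
  destruct (automorphism_symbol psi T Hpsi Npsi HT) as [phi [A1 [A2 A3]]].
  destruct (automorphism_symbol psi S Hpsi Npsi HS) as [eta [B1 [B2 B3]]].
  assert (L1 : forall z, Cmod z < 1 -> eta (phi z) = z)
    by (apply (automorphism_symbol_inverse psi T S); assumption).
  assert (L2 : forall z, Cmod z < 1 -> phi (eta z) = z)
    by (apply (automorphism_symbol_inverse psi S T); assumption).
  assert (Hphi : disc_automorphism phi).
  { split.
    - split; [exact A2|split].
      + intros x y Hx Hy E. rewrite <- (L1 x Hx), <- (L1 y Hy). now f_equal.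
      + intros y Hy. exists (eta y). split; [now apply B2|now apply L2].
    - intros z Hz. now apply ex_derive_iff_cdiff, A1. }
  destruct (disc_automorphism_disc_map phi Hphi) as (m & n & Phi & Psi & Hm & _ & Heq & _).
  assert (Hself := principal_ideal_self psi).
  assert (Np := automorphism_psi_nonzero psi Hpsi Npsi T HT).
  assert (DA : forall h, principal_ideal psi h -> disc_algebra h).
  { intros h. now apply principal_ideal_disc_algebra. }
  assert (DT : forall h, principal_ideal psi h -> disc_algebra (T h)).
  { intros h Hh. now apply DA, automorphism_maps. }
  assert (Hcomp : forall f, principal_ideal psi f -> T f = composition_operator Phi f).
  (* [A3] gives the identity in the open disc off the zeros of T psi; both sides are continuous on
     the closed disc. *)
  { intros f Hf. apply (eq_off_zeros _ _ (ext (T psi))); [| | |exact Np|].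
    - intros x. now apply disc_algebra_continuous, DT.
    - intros x. apply disc_algebra_continuous, (disc_map_comp f m); [exact Hm|now apply DA].
    - now apply disc_algebra_analytic, DT.
    - intros x Hx N. rewrite ext_cdval in N. apply (A3 x (Phi x) N); [|exact Hf].
      rewrite (proj2 (proj2 Hm)). symmetry. now apply Heq. }
  exists phi, Phi. split; [exact Hphi|]. split; [|split; [exact Hcomp|]].
  { split; [now apply (disc_map_continuous m)|].
    intros x Hx. rewrite (proj2 (proj2 Hm)). symmetry. now apply Heq. }
  destruct (automorphism_maps psi T HT psi Hself) as [g [Hg Eg]].
  destruct (automorphism_maps psi S HS psi Hself) as [k [Hk Ek]].
  exists g. split; [|now rewrite <- Hcomp].
  split; [exact Hg|].
  assert (HkPhi : disc_algebra (fun x => k (Phi x))) by now apply (disc_map_comp k m).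
  exists (fun x => k (Phi x)). split; [exact HkPhi|].
  assert (E : (fun x => g x * k (Phi x))%C = (fun _ => RtoC 1)).
  { apply (eq_off_zeros _ _ (ext psi)).
    - intros x. now apply disc_algebra_continuous, disc_algebra_mult.
    - intros x. apply Clim_const. typeclasses eauto.
    - now apply disc_algebra_analytic.
    - now apply disc_algebra_nonzero.
    - intros x _ N. rewrite ext_cdval in N.
      assert (E1 : psi (Phi x) = (psi x * g x)%C).
      { rewrite <- (f_equal (fun h => h x) Eg). now rewrite Hcomp. }
      (* This is T (S psi) = psi with S psi = psi k; with [E1] it reads psi g (k o Phi) = psi, and
         psi can be cancelled off its zeros. *)
      assert (E2 : (psi (Phi x) * k (Phi x))%C = psi x).
      { rewrite <- (f_equal (fun h => h x) (TS psi Hself)).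
        rewrite Hcomp by now apply automorphism_maps.
        unfold composition_operator. now rewrite Ek. }
      rewrite E1 in E2.
      replace (g x * k (Phi x))%C with ((psi x * g x * k (Phi x)) / psi x)%C by (field; exact N).
      rewrite E2. field. exact N. }
  intros x. exact (f_equal (fun h => h x) E).
Qed.

Theorem corollary4p5
  (psi : closed_disc -> C)
  (psi_in : disc_algebra psi)
  (psi_nonzero : ~ (forall z : closed_disc, psi z = RtoC 0))
  (T : (closed_disc -> C) -> (closed_disc -> C))
  (T_maps : maps_into (principal_ideal psi) T) :
  algebra_automorphism_on (principal_ideal psi) T <->
  exists (phi : C -> C) (Phi : closed_disc -> closed_disc),
    disc_automorphism phi /\
    continuous_extension phi Phi /\
    (forall f : closed_disc -> C,
       principal_ideal psi f -> T f = composition_operator Phi f) /\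
    exists g : closed_disc -> C,
      disc_algebra_invertible g /\
      composition_operator Phi psi = (fun z => Cmult (psi z) (g z)).
Proof.
  split.
  - now apply composition_of_automorphism.
  - intros (phi & Phi & Hphi & Hext & HT & g & Hg & Hpg).
    now apply (automorphism_of_composition psi T phi Phi g).
Qed.
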